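(* There is an absolute constant $C>0$ such that the following holds. Let $\mathcal{G}=(G_1,\dots,G_T)$ be an always-connected temporal graph on $n\ge 2$ vertices whose underlying graph is outerplanar, and suppose $T\ge C\,n^{4/3}\log^{2.5}n$. Then a single agent starting at any given vertex can visit all vertices of $\mathcal{G}$ using only the snapshots $G_1,\dots,G_{\lceil Cn^{4/3}\log^{2.5}n\rceil}$.
   Context: A temporal graph $\mathcal{G}=(G_1,\dots,G_T)$ on a vertex set $V$ is a sequence of simple undirected graphs $G_t=(V,E_t)$. It is always-connected if each $G_t$ is connected. Its underlying graph is $(V,\bigcup_tE_t)$. A temporal walk is a sequence $((v_0,v_1),t_1),\dots,((v_{\ell-1},v_\ell),t_\ell)$ with $\{v_{j-1},v_j\}\in E_{t_j}$ and $t_1<\dots<t_\ell$. Waiting is allowed, and the walk visits $v_0,\dots,v_\ell$. *)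

(* Defs.v *)
From HB Require Import structures.
From mathcomp Require Export all_boot all_order all_algebra.
From mathcomp Require Export all_classical all_reals all_analysis.
Export Order.TTheory GRing.Theory Num.Theory.
Export numFieldNormedType.Exports.

Set Implicit Arguments.
Unset Strict Implicit.
Unset Printing Implicit Defensive.

Local Open Scope classical_set_scope.
Local Open Scope ring_scope.

Record sgraph (V : finType) := SGraph {
  adj : rel V;
  adj_sym : symmetric adj;
  adj_irr : irreflexive adj }.

Definition graph_connected (V : finType) (G : sgraph V) : Prop :=
  forall x y : V, connect (adj G) x y.

(* The snapshot G_t, t = 1, ..., T, is [G i] for the i : 'I_T with
   i.+1 = t. *)
Definition temporal_graph (V : finType) (T : nat) := 'I_T -> sgraph V.

Section TemporalGraph.
Variables (V : finType) (T : nat) (G : temporal_graph V T).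

Definition always_connected : Prop := forall i : 'I_T, graph_connected (G i).

Definition underlying_adj : rel V := fun x y => [exists i : 'I_T, adj (G i) x y].

Lemma underlying_adj_sym : symmetric underlying_adj.
Proof. by move=> x y; apply: eq_existsb => i; rewrite adj_sym. Qed.

Lemma underlying_adj_irr : irreflexive underlying_adj.
Proof. by move=> x; apply/existsP => -[i]; rewrite adj_irr. Qed.

Definition underlying : sgraph V := SGraph underlying_adj_sym underlying_adj_irr.

(* A step ((u, v), i) crosses the edge uv, from u to v, in the snapshot [G i]. *)
Definition step := ((V * V) * 'I_T)%type.

Definition follows (a b : step) : bool := (a.1.2 == b.1.1) && (a.2 < b.2)%N.

Definition temporal_walk (s : V) (w : seq step) : bool :=
  [&& all (fun a : step => adj (G a.2) a.1.1 a.1.2) w,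
      sorted follows w
    & if w is a :: _ then a.1.1 == s else true].

Definition visited (s : V) (w : seq step) : seq V :=
  s :: [seq a.1.2 | a : step <- w].

End TemporalGraph.

Section Outerplanar.
Variables (R : realType) (V : finType) (G : sgraph V).

Definition is_arc (A : set (R * R)) (p q : R * R) : Prop :=
  exists f : R -> R * R,
    [/\ {within `[0, 1], continuous f}, set_inj `[0, 1] f,
        f 0 = p, f 1 = q & A = f @` `[0, 1]].

Record plane_drawing := PlaneDrawing {
  point : V -> R * R;
  arc : V -> V -> set (R * R);
  point_inj : injective point;
  arcC : forall x y, adj G x y -> arc x y = arc y x;
  arcP : forall x y, adj G x y -> is_arc (arc x y) (point x) (point y);
  arc_point : forall x y z, adj G x y -> arc x y (point z) -> z = x \/ z = y;
  arc_meet : forall x y z w, adj G x y -> adj G z w ->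
    [set x; y] <> [set z; w] ->
    arc x y `&` arc z w `<=` point @` ([set x; y] `&` [set z; w]) }.

Definition drawn (D : plane_drawing) : set (R * R) :=
  range (point D) `|` [set p | exists x y, adj G x y /\ arc D x y p].

(* As [drawn D] is compact, its complement has exactly one unbounded connected
   component, which is therefore the whole of this set. *)
Definition outer_face (D : plane_drawing) : set (R * R) :=
  [set p | (~` drawn D) p /\
           ~ bounded_set (connected_component (~` drawn D) p)].

(* Vertices lie outside every face, so membership in the closure of the outer
   face means membership in its boundary. *)
Definition outerplanar : Prop :=
  exists D : plane_drawing, forall x : V, closure (outer_face D) (point D x).

End Outerplanar.

(* C n^(4/3) (log n)^(5/2), with the natural logarithm. *)
Definition exploration_bound (R : realType) (C : R) (n : nat) : R :=
  C * n%:R `^ (4%:R / 3%:R) * (ln n%:R) `^ (5%:R / 2%:R).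

(* Main.v *)
(* By a mod 2 count of crossings, an outerplanar graph has no K4 minor (a vertex
   placed in the outer face would turn it into a drawing of K5), so vertices of
   degree at most 2 can be eliminated one by one.  The resulting tree gives
   balanced separators of size 3, hence a division of every vertex set [C] into
   few much smaller pieces with boundaries of logarithmic size.

   If [B] separates [C] from the rest, then in any time window a little longer
   than [2 |C|] every [c] in [C] can both reach and be reached from some [p] in
   [B] without leaving [C :|: B].  By pigeonhole, an agent waiting at a suitable
   [p] can within a few such windows go to [c], stay there for a while and come
   back to [p].  Recursively, with [c] on the boundary of a piece of [C] and the
   stay used for excursions into that piece, the total time on four scales
   1 < x < x^2 < x^3 < x^4, where x is about n^(1/4), is n^(5/4) up to powers of
   log n. *)

Require Import Defs.
From mathcomp Require Import zify ring lra.

Set Implicit Arguments.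
Unset Strict Implicit.
Unset Printing Implicit Defensive.

(** * K4 minors and elimination orders of width two *)

Section TreeOrders.
Import mathcomp.boot.fintype mathcomp.boot.finset.
Implicit Types (V : finType).

(** The obstacle in the recursion is that the vertex where an excursion starts and ends cannot be
    prescribed: it depends on the time and on what is still unvisited. The invariant therefore
    promises only some vertex of [B] and only a fraction [1/q] of any given set. Choosing one good
    piece divides this fraction by the number of pieces, about [x]; repeating the excursion restores
    it to [1/(2|B|)] and multiplies the time by the same factor. With [i] scales and [x] about
    [n^(1/i)] this costs about [x^(i+1) = n^(1+1/i)] times powers of log n. Three scales would
    already give the exponent 4/3, but with too many logarithms; with four, the gap between 5/4 and
    4/3 absorbs all of them. On the planar side no Jordan curve theorem is used: arcs are replaced
    by finite chains of points with short steps, for which crossing parities are a finite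
    computation. *)

Definition induced V (H : rel V) (A : {set V}) : rel V :=
  [rel x y | [&& x \in A, y \in A & H x y]].

Definition connected_in V (H : rel V) (A : {set V}) : Prop :=
  {in A &, forall x y, connect (induced H A) x y}.

Definition K4_minor V (H : rel V) (W : {set V}) : Prop :=
  exists A : 'I_4 -> {set V},
    [/\ forall i, A i \subset W, forall i, A i != set0,
        forall i, connected_in H (A i),
        forall i j, i != j -> [disjoint A i & A j]
      & forall i j, i != j -> exists x y, [/\ x \in A i, y \in A j & H x y]].

Lemma induced_sym V (H : rel V) A : symmetric H -> symmetric (induced H A).
Proof. by move=> sH x y; rewrite /induced /= sH andbCA. Qed.

Definition segment V (s : seq V) a b : {set V} :=
  [set x in s | a <= index x s < b].

Lemma connected_segment V (H : rel V) (s : seq V) a b :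
  symmetric H -> uniq s -> sorted H s -> connected_in H (segment s a b).
Proof.
move=> sH us ps.
have step n : forall x y, x \in segment s a b -> y \in segment s a b ->
    index y s = index x s + n -> connect (induced H (segment s a b)) x y.
  elim: n => [|n IH] x y xS yS.
    rewrite addn0 => e; move: (xS) (yS); rewrite !inE.
    move=> /andP[xs _] /andP[ys _].
    by rewrite -(nth_index x xs) -(nth_index x ys) e connect0.
  rewrite addnS => e; move: (xS) (yS); rewrite !inE.
  move=> /andP[xs /andP[ax xb]] /andP[ys /andP[ay yb]].
  have lty : index y s < size s by rewrite index_mem.
  set z := nth x s (index x s + n).
  have iz : index z s = index x s + n.
    by rewrite index_uniq //; apply: leq_trans lty; lia.
  have zS : z \in segment s a b.
    rewrite !inE iz mem_nth /=; first by lia.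
    by apply: leq_trans lty; lia.
  apply: connect_trans (IH x z xS zS iz) _; apply: connect1.
  rewrite /induced /= zS yS /=.
  move: (sortedP x ps (index x s + n)).
  by rewrite -e nth_index // => ->.
move=> x y xS yS; case: (leqP (index x s) (index y s)) => h.
  by apply: (step (index y s - index x s)) => //; lia.
rewrite (sym_connect_sym (induced_sym _ sH)).
by apply: (step (index x s - index y s)) => //; lia.
Qed.

Lemma ex_third_neighbour V (N : {set V}) (a b : V) :
  2 < #|N| -> exists2 u, u \in N & (u != a) && (u != b).
Proof.
move=> hN; have /set0Pn[u] : N :\: [set a; b] != set0.
  rewrite setD_eq0; apply/negP => /subset_leq_card.
  by rewrite cards2; case: (a != b) => /=; lia.
by rewrite !inE negb_or => /andP[h uN]; exists u.
Qed.

Definition path_in V (H : rel V) (W : {set V}) (s : seq V) : bool :=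
  [&& uniq s, all (mem W) s & sorted H s].

(** A rotation: the reversed prefix ends in the old first vertex, and the chord from there to
    position [i] links it to the rest. The new first vertex is the one at position [i - 1]. *)
Lemma rotate_path_in V (H : rel V) (W : {set V}) d s i :
  symmetric H -> path_in H W s -> 0 < i < size s -> H (nth d s 0) (nth d s i) ->
  path_in H W (rev (take i s) ++ drop i s).
Proof.
move=> sH /and3P[us ws ps] /andP[i0 ilt] hi.
have pe : perm_eq (rev (take i s) ++ drop i s) s.
  by rewrite -[X in perm_eq _ X](cat_take_drop i s) perm_cat2r perm_rev.
apply/and3P; split; first by rewrite (perm_uniq pe).
  by rewrite (perm_all _ pe).
have szt : size (take i s) = i by rewrite size_take ilt.
apply/(sortedP d) => k; rewrite size_cat size_rev szt size_drop => hk.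
rewrite !nth_cat size_rev szt.
case: (ltnP k.+1 i) => h1.
  rewrite (ltn_trans (ltnSn k) h1) !nth_rev ?szt; try lia.
  rewrite !nth_take; try lia.
  have := sortedP d ps (i - k.+2).
  have -> : (i - k.+2).+1 = i - k.+1 by lia.
  by rewrite sH; apply; lia.
case: (ltnP k i) => h2.
  have -> : k = i.-1 by lia.
  rewrite nth_rev ?szt; last lia.
  rewrite nth_take; last lia.
  have -> : i - i.-1.+1 = 0 by lia.
  by rewrite nth_drop; have -> : i + (i.-1.+1 - i) = i by lia.
rewrite !nth_drop; have -> : i + (k.+1 - i) = (i + (k - i)).+1 by lia.
by apply: (sortedP d ps); lia.
Qed.

(* Among the longest paths choose one whose first vertex [v0] has its second
   neighbour [vi] on the path as close as possible.  Reversing the part before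
   [vi] gives a longest path starting at [v(i-1)], so a third neighbour of
   [v(i-1)] lies beyond [vi]; together with a third neighbour of [v0] it closes
   a K4. *)
Lemma min_degree3_K4_minor V (H : rel V) (W : {set V}) :
  symmetric H -> irreflexive H -> W != set0 ->
  {in W, forall v, 2 < #|[set u in W | H v u]|} -> K4_minor H W.
Proof.
move=> sH iH /set0Pn[d dW] deg.
pose P k := `[< exists2 s, path_in H W s & size s = k >].
have exP : exists k, P k.
  by exists 1; apply/asboolP; exists [:: d] => //; rewrite /path_in /= dW.
have ubP k : P k -> k <= #|V|.
  move=> /asboolP[s /and3P[us _ _] <-].
  by rewrite -(card_uniqP us); apply: max_card.
case: (ex_maxnP exP ubP) => k /asboolP[s0 gs0 szs0] kmax.
have k_gt0 : 0 < k.
  apply: kmax; apply/asboolP; exists [:: d] => //.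
  by rewrite /path_in /= dW.
have in_path s u : path_in H W s -> size s = k -> u \in W ->
    H (nth d s 0) u -> u \in s.
  move=> gs szs uW hu; apply/negP => us.
  suff /kmax : P k.+1 by rewrite ltnn.
  apply/asboolP; exists (u :: s); last by rewrite /= szs.
  move: gs => /and3P[us' ws ps]; apply/and3P; split => /=.
  - by rewrite us' andbT; apply/negP.
  - by rewrite ws uW.
  - case: s szs ps {us us' ws} hu => [|x s] //= sz -> hu.
    by rewrite sH hu.
have third s a b : path_in H W s -> size s = k ->
    exists2 l, l < k & [/\ nth d s l != a, nth d s l != b &
      H (nth d s 0) (nth d s l)].
  move=> gs szs.
  have v0W : nth d s 0 \in W.
    by move: gs => /and3P[_ /allP ws _]; apply/ws/mem_nth; rewrite szs.
  have [u] := ex_third_neighbour a b (deg _ v0W).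
  rewrite !inE => /andP[uW hu] /andP[ua ub].
  have us := in_path s u gs szs uW hu.
  exists (index u s); first by rewrite -szs index_mem.
  by rewrite nth_index.
pose Q i := `[< exists s, [/\ path_in H W s, size s = k, 1 < i < k &
                              H (nth d s 0) (nth d s i)] >].
have exQ : exists i, Q i.
  have [l lk [_ l1 hl]] := third s0 d (nth d s0 1) gs0 szs0.
  exists l; apply/asboolP; exists s0; split=> //; rewrite lk andbT.
  by case: l {lk} l1 hl => [|[|l]] //; rewrite ?eqxx // iH.
case: (ex_minnP exQ) => i /asboolP[s [gs szs /andP[i1 ik] hi]] imin.
have i0 : 0 < i < size s by lia.
pose s' := rev (take i s) ++ drop i s.
have gs' : path_in H W s' := rotate_path_in sH gs i0 hi.
have szs' : size s' = k by rewrite size_cat size_rev -size_cat cat_take_drop.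
have nth_s' m : m < i -> nth d s' m = nth d s (i - m.+1).
  move=> mi; have szt : size (take i s) = i by rewrite size_take; case: ifP; lia.
  by rewrite nth_cat size_rev szt mi nth_rev ?szt // nth_take //; lia.
have [j2 [jk2 ji2 j12 hj2]] : exists j2, [/\ j2 < k, j2 != i, j2 != 1 &
    H (nth d s 0) (nth d s j2)].
  have [m mk [m1 mi hm]] := third s (nth d s 1) (nth d s i) gs szs.
  exists m; split=> //; first by apply: contraNneq mi => ->.
  by apply: contraNneq m1 => ->.
have j2_gt : i < j2.
  rewrite ltn_neqAle eq_sym ji2 /=; apply: imin; apply/asboolP; exists s.
  split=> //; rewrite jk2 andbT.
  by case: (j2) hj2 j12 => [|[|m]] //; rewrite iH.
have [l [lk li2 li hl]] : exists l, [/\ l < k, l != i - 2, l != i &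
    H (nth d s i.-1) (nth d s l)].
  have [m mk [m1 mi hm]] := third s' (nth d s (i - 2)) (nth d s i) gs' szs'.
  have e : nth d s' 0 = nth d s i.-1 by rewrite nth_s' ?subn1 //; clear -i1; lia.
  rewrite e in hm.
  have ms : nth d s' m \in s.
    have pe : perm_eq s' s.
      by rewrite -[X in perm_eq _ X](cat_take_drop i s) perm_cat2r perm_rev.
    by rewrite -(perm_mem pe) mem_nth // szs'.
  exists (index (nth d s' m) s).
  rewrite -szs index_mem ms nth_index //; split=> //.
    by apply: contraNneq m1 => <-; rewrite nth_index.
  by apply: contraNneq mi => <-; rewrite nth_index.
have l_gt : i < l.
  rewrite ltnNge; apply/negP => hle.
  have lni : l != i.-1 by apply: contraTneq hl => ->; rewrite iH.
  (* On the rotated path position [l] becomes [i.-1 - l], which exceeds 1 because [l] is neither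
     [i.-1] nor [i - 2]; this contradicts the minimality of [i]. *)
  have : i <= i.-1 - l.
    apply: imin; apply/asboolP; exists s'; split=> //; first by lia.
    rewrite !nth_s'; try by clear -i1 hle lni li2; lia.
    have -> : i - 1 = i.-1 by lia.
    by have -> : i - (i.-1 - l).+1 = l by lia.
  lia.
move: (gs) => /and3P[us /allP ws ps].
have [m [M [im mM Mk ml mj]]] : exists m M,
    [/\ i < m, m <= M, M < k, m <= l <= M & m <= j2 <= M].
  by exists (minn l j2), (maxn l j2); clear -l_gt j2_gt lk jk2; split; lia.
(* The branch sets are the positions below [i.-1], [i.-1] alone, those from [i] to [m.-1], and those
   from [m] to [M]. Consecutive ones are linked by the path; the chords from 0 to [i], from 0 to
   [j2] and from [i.-1] to [l] supply the other three pairs. *)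
pose lo (r : 'I_4) := nth 0 [:: 0; i.-1; i; m] r.
pose hi' (r : 'I_4) := nth 0 [:: i.-1; i; m; M.+1] r.
have seg x r : x < k -> lo r <= x < hi' r ->
    nth d s x \in segment s (lo r) (hi' r).
  by move=> xk hx; rewrite !inE mem_nth ?szs // index_uniq ?szs.
exists (fun r => segment s (lo r) (hi' r)); split.
- by move=> r; apply/subsetP => x; rewrite !inE => /andP[/ws].
- move=> r; apply/set0Pn; exists (nth d s (lo r)); apply: seg.
    by case: r => -[|[|[|[|//]]]] ? ; rewrite /lo /=; clear -i1 ik im mM Mk; lia.
  by case: r => -[|[|[|[|//]]]] ? ; rewrite /lo /hi' /=; clear -i1 im mM; lia.
- by move=> r; apply: connected_segment.
- move=> r r' rr'; rewrite disjoints_subset; apply/subsetP => x.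
  rewrite !inE => /andP[-> /=] h; apply/negP; move: h rr'.
  by case: r => -[|[|[|[|//]]]] ?; case: r' => -[|[|[|[|//]]]] ? //;
     rewrite /lo /hi' /= => h _; clear -h i1 im mM; lia.
have sufflt : (forall r r' : 'I_4, r < r' -> exists x y,
    [/\ x \in segment s (lo r) (hi' r), y \in segment s (lo r') (hi' r') &
        H x y]) ->
  forall r r' : 'I_4, r != r' -> exists x y,
    [/\ x \in segment s (lo r) (hi' r), y \in segment s (lo r') (hi' r') &
        H x y].
  move=> h r r'; rewrite neq_ltn => /orP[/h//|/h[x [y [hx hy hxy]]]].
  by exists y, x; split; rewrite // sH.
apply: sufflt => r r' rr'.
have ord a b : a < k -> b < k -> lo r <= a < hi' r -> lo r' <= b < hi' r' ->
    H (nth d s a) (nth d s b) -> exists x y,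
    [/\ x \in segment s (lo r) (hi' r), y \in segment s (lo r') (hi' r') &
        H x y].
  by move=> ak bk ha hb hab; exists (nth d s a), (nth d s b); split=> //; exact: seg.
have nxt a : a.+1 < k -> H (nth d s a) (nth d s a.+1).
  by move=> ak; apply: (sortedP d ps); rewrite szs.
case: r rr' ord => -[|[|[|[|//]]]] ?; case: r' => -[|[|[|[|//]]]] ? //= _;
  rewrite /lo /hi' /= => ord.
- apply: (ord (i - 2) i.-1); try by clear -i1 ik; lia.
  have -> : i.-1 = (i - 2).+1 by clear -i1; lia.
  by apply: nxt; clear -i1 ik; lia.
- by apply: (ord 0 i) => //; clear -i1 ik im; lia.
- by apply: (ord 0 j2) => //; clear -i1 ik mj jk2; lia.
- apply: (ord i.-1 i); try by clear -i1 ik im; lia.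
  have {2}-> : i = i.-1.+1 by clear -i1; lia.
  by apply: nxt; clear -i1 ik; lia.
- by apply: (ord i.-1 l) => //; clear -i1 ik ml lk; lia.
- apply: (ord m.-1 m); try by clear -i1 ik im mM Mk; lia.
  have {2}-> : m = m.-1.+1 by clear -im; lia.
  by apply: nxt; clear -im mM Mk; lia.
Qed.

(** The fill-in of an elimination step; removing [v] itself is left to the vertex set [W :\ v]. *)
Definition eliminate V (H : rel V) v : rel V :=
  [rel x y | H x y || [&& x != y, H v x & H v y]].

(** As [v] has at most two neighbours in [W], the fill-in there is at most one edge, at some
    neighbour [a]. Adding [v] to the branch set containing [a], if any, replaces that edge by the
    detour through [v]. *)
Lemma eliminate_K4_minor V (H : rel V) (W : {set V}) v :
  symmetric H -> v \in W -> #|[set u in W | H v u]| <= 2 ->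
  K4_minor (eliminate H v) (W :\ v) -> K4_minor H W.
Proof.
move=> sH vW; set N := [set u in W | H v u] => cN [A [AW A0 Ac Ad Ae]].
have {}AW i x : x \in A i -> (x != v) && (x \in W).
  by move/(subsetP (AW i)); rewrite !inE.
(* If [v] has no neighbour in [W], the default [a = v] lies in no branch set, so nothing changes. *)
have [a va aP] : exists2 a, a != v -> H v a &
    forall x y, x \in W :\ v -> y \in W :\ v -> eliminate H v x y ->
      H x y \/ ((x = a /\ H v y) \/ (y = a /\ H v x)).
  case: (set_0Vmem N) => [N0|[a]].
    exists v => [|x y]; first by rewrite eqxx.
    rewrite !inE => /andP[_ xW] _ /orP[|/and3P[_ hx _]]; first by left.
    by have : x \in N; [rewrite inE xW hx|rewrite N0 inE].
  rewrite inE => /andP[aW va]; exists a => // x y.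
  rewrite !inE => /andP[_ xW] /andP[_ yW] /orP[|/and3P[xy hx hy]]; first by left.
  right; case: (eqVneq x a) => [->|xa]; first by left.
  case: (eqVneq y a) => [->|ya]; first by right.
  have : [set x; y; a] \subset N.
    by apply/subsetP => z; rewrite !inE => /orP[/orP[]|] /eqP->; apply/andP.
  move/subset_leq_card; rewrite setUC cardsU1 cards2 !inE negb_or.
  by rewrite ![a == _]eq_sym xa ya xy => /leq_trans/(_ cN).
pose B i := if a \in A i then v |: A i else A i.
have AB i x : x \in A i -> x \in B i.
  by rewrite /B; case: ifP; rewrite ?inE => // _ ->; rewrite orbT.
have inW i x : x \in A i -> x \in W :\ v by move/AW; rewrite !inE.
exists B; split.
- move=> i; apply/subsetP => x; rewrite /B; case: ifP => _; rewrite ?inE.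
    by case/orP => [/eqP->|/AW/andP[]].
  by case/AW/andP.
- by move=> i; have /set0Pn[x xA] := A0 i; apply/set0Pn; exists x; apply: AB.
- move=> i; rewrite /B; case: ifP => ai; last first.
    move=> x y xA yA; apply: connect_sub (Ac i x y xA yA) => {xA yA} {}x {}y.
    rewrite /induced /= => /and3P[xA yA h]; apply: connect1; rewrite /= xA yA /=.
    have [//|[[e _]|[e _]]] := aP x y (inW _ _ xA) (inW _ _ yA) h.
      by rewrite -e xA in ai.
    by rewrite -e yA in ai.
  pose R := induced H (v |: A i).
  have sR : connect_sym R by apply/sym_connect_sym/induced_sym.
  have AB' x : x \in A i -> x \in v |: A i by rewrite !inE orbC => ->.
  have vB : v \in v |: A i by rewrite !inE eqxx.
  have cva : connect R v a.
    apply: connect1; rewrite /R /induced /= vB AB' // va //.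
    by have /andP[] := AW _ _ ai.
  have cA x y : x \in A i -> y \in A i -> connect R x y.
    move=> xA yA; apply: connect_sub (Ac i x y xA yA) => {xA yA} {}x {}y.
    rewrite /induced /= => /and3P[xA yA h].
    have [h'|[[e h']|[e h']]] := aP x y (inW _ _ xA) (inW _ _ yA) h.
    + by apply: connect1; rewrite /R /induced /= !AB'.
    + rewrite e; apply: (connect_trans (y := v)); first by rewrite sR.
      by apply: connect1; rewrite /R /induced /= vB AB'.
    + rewrite e; apply: connect_trans cva.
      by apply: connect1; rewrite /R /induced /= vB AB' // sH.
  have cv y : y \in v |: A i -> connect R v y.
    case/setU1P => [->|yA]; first exact: connect0.
    exact: connect_trans cva (cA _ _ ai yA).
  by move=> x y xB yB; apply: connect_trans (cv y yB); rewrite -/R sR cv.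
- move=> i j ij; have := Ad i j ij; rewrite !disjoints_subset.
  move=> /subsetP dis; apply/subsetP => x; rewrite inE.
  have vi m : (v \in A m) = false by apply/negP => /AW; rewrite eqxx.
  have disj z : z \in A i -> z \in A j -> False.
    by move=> /dis; rewrite inE => /negP.
  rewrite /B; case: ifP => ai; case: ifP => aj; rewrite ?inE ?negb_or.
  + by case: (disj a).
  + by case/orP => [/eqP->|/dis]; rewrite ?vi ?inE.
  + move=> xi; apply/andP; split; first by apply: contraTneq xi => ->; rewrite vi.
    by apply/negP; exact: disj xi.
  + by move/dis; rewrite inE.
- move=> i j ij; have [x [y [xi yj h]]] := Ae i j ij.
  have vB m : a \in A m -> v \in B m by rewrite /B => ->; rewrite !inE eqxx.
  have [h'|[[e h']|[e h']]] := aP x y (inW _ _ xi) (inW _ _ yj) h.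
  + by exists x, y; split; [exact: AB|exact: AB|].
  + by exists v, y; split; [apply: vB; rewrite -e|exact: AB|].
  + by exists x, v; split; [exact: AB|apply: vB; rewrite -e|rewrite sH].
Qed.

(** A tree decomposition with bags [v |: up v] of size at most 3. In the construction below, [up v]
    consists of the neighbours of [v], fill-in included, that are still present when [v] is
    eliminated. The root is its own parent, so that iterating [par] ends there. *)
Record tree_order V (H : rel V) (W : {set V}) (root : V) (rank : V -> nat)
    (par : V -> V) (up : V -> {set V}) : Prop := TreeOrder {
  root_in : root \in W;
  up_root : up root = set0;
  par_root : par root = root;
  card_up : {in W, forall v, #|up v| <= 2};
  edge_up : {in W &, forall u v, H u v -> u \in up v \/ v \in up u};
  par_in : {in W, forall v, v != root -> par v \in W};
  rank_par : {in W, forall v, v != root -> rank (par v) < rank v};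
  up_par : {in W, forall v, v != root -> up v \subset par v |: up (par v)} }.

Lemma tree_order_exists V (H : rel V) (W : {set V}) :
  symmetric H -> irreflexive H -> W != set0 -> ~ K4_minor H W ->
  exists root rank par up, tree_order H W root rank par up.
Proof.
move: {2}#|W| (leqnn #|W|) => n.
elim: n H W => [|n IH] H W; first by rewrite leqn0 cards_eq0 => ->.
move=> Wn sH iH W0 noK.
have [v vW dv] : exists2 v, v \in W & #|[set u in W | H v u]| <= 2.
  apply: contrapT => h; apply: noK; apply: min_degree3_K4_minor => // v vW.
  by rewrite ltnNge; apply/negP => hv; apply: h; exists v.
case: (eqVneq (W :\ v) set0) => W'0.
  have Wv u : u \in W -> u = v.
    move=> uW; apply/eqP; apply: contraTT isT => uv.
    by have : u \in W :\ v; [rewrite !inE uv|rewrite W'0 inE].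
  exists v, (fun=> 0), id, (fun=> set0); split=> //.
  - by move=> u _; rewrite cards0.
  - by move=> x y /Wv-> /Wv->; rewrite iH.
  - by move=> x /Wv->; rewrite eqxx.
  - by move=> x _ _; rewrite sub0set.
pose N := [set u in W | H v u].
have [root [rank [par [up T]]]] : exists root rank par up,
    tree_order (eliminate H v) (W :\ v) root rank par up.
  apply: IH => //.
  - by move: Wn; rewrite (cardsD1 v) vW.
  - by move=> x y; rewrite /eliminate /= sH eq_sym [H v x && _]andbC.
  - by move=> x; rewrite /eliminate /= iH eqxx.
  - by move=> K; apply: noK; apply: eliminate_K4_minor K.
have NW u : u \in N -> u \in W :\ v.
  by rewrite !inE => /andP[-> h]; rewrite andbT; apply: contraTneq h => ->; rewrite iH.
(* Two remaining neighbours are adjacent after the fill-in, so one has the other in its [up] and can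
   serve as the parent. *)
have [p pW Np] : exists2 p, p \in W :\ v & N \subset p |: up p.
  case: (set_0Vmem N) => [->|[a aN]].
    by exists root; [exact: root_in T|exact: sub0set].
  case: (set_0Vmem (N :\ a)) => [Na|[b]].
    exists a; first exact: NW.
    apply/subsetP => x xN; move: (in_set0 x); rewrite -Na in_setD1 xN andbT.
    by move=> /negbFE/eqP->; rewrite !inE eqxx.
  rewrite in_setD1 => /andP[ba bN].
  have NE : N = [set a; b].
    apply/esym/eqP; rewrite eqEcard cards2 eq_sym ba dv andbT.
    by apply/subsetP => x /set2P[]->.
  have hab : eliminate H v a b.
    by move: aN bN; rewrite /eliminate !inE /= => /andP[_ ->] /andP[_ ->]; rewrite eq_sym ba orbT.
  have [h|h] := edge_up T (NW _ aN) (NW _ bN) hab.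
    exists b; first exact: NW.
    by rewrite NE; apply/subsetP => x /set2P[]->; rewrite !inE ?h ?eqxx ?orbT.
  exists a; first exact: NW.
  by rewrite NE; apply/subsetP => x /set2P[]->; rewrite !inE ?h ?eqxx ?orbT.
exists root, [eta rank with v |-> (\max_(y in W :\ v) rank y).+1],
  [eta par with v |-> p], [eta up with v |-> N].
have rv : (root == v) = false by have := root_in T; rewrite !inE => /andP[/negbTE].
have W'P x : x \in W -> x != v -> x \in W :\ v by move=> xW xv; rewrite !inE xv.
have pv x : x \in W :\ v -> (x == v) = false by rewrite !inE => /andP[/negbTE].
have W'W x : x \in W :\ v -> x \in W by rewrite !inE => /andP[].
split=> /=.
- by apply: W'W; exact: root_in T.
- by rewrite rv (up_root T).
- by rewrite rv (par_root T).
- move=> x xW /=; case: (eqVneq x v) => [_|xv]; first exact: dv.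
  by apply: (card_up T); apply: W'P.
- move=> x y xW yW h /=.
  case: (eqVneq y v) => [e|yv]; case: (eqVneq x v) => [e'|xv].
  + by move: h; rewrite e e' iH.
  + by left; rewrite !inE xW sH -e.
  + by right; rewrite !inE yW -e'.
  + by apply: (edge_up T (W'P _ xW xv) (W'P _ yW yv)); rewrite /eliminate /= h.
- move=> x xW xr /=; case: (eqVneq x v) => [_|xv]; first exact: W'W.
  by apply: W'W; apply: (par_in T) => //; apply: W'P.
- move=> x xW xr /=; case: (eqVneq x v) => [_|xv].
    by rewrite pv //= ltnS; apply: (leq_bigmax_cond (F := rank)).
  have xW' := W'P _ xW xv.
  by rewrite (pv _ (par_in T xW' xr)) (rank_par T).
- move=> x xW xr /=; case: (eqVneq x v) => [_|xv]; first by rewrite pv.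
  have xW' := W'P _ xW xv.
  by rewrite (pv _ (par_in T xW' xr)) (up_par T).
Qed.

End TreeOrders.

(** * Balanced separators and divisions into pieces *)

Section Separators.
Import mathcomp.boot.fintype mathcomp.boot.finset.
Implicit Types (V : finType).

Definition closed_off V (H : rel V) (C B : {set V}) : Prop :=
  forall u w, u \in C -> H u w -> w \in C \/ w \in B.

Definition descendants V (par : V -> V) v : {set V} :=
  [set u | fconnect par u v].

Lemma descendants_trans V (par : V -> V) u v w :
  u \in descendants par v -> v \in descendants par w -> u \in descendants par w.
Proof. by rewrite !inE; apply: connect_trans. Qed.

Lemma par_descendants V (par : V -> V) u v :
  par u \in descendants par v -> u \in descendants par v.
Proof. by rewrite !inE; apply: connect_trans; apply: fconnect1. Qed.

Lemma descendants_ind V (par : V -> V) v (P : V -> Prop) :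
  P v -> (forall u, par u \in descendants par v -> P (par u) -> P u) ->
  forall u, u \in descendants par v -> P u.
Proof.
move=> Pv Pstep u; rewrite inE => /connectP[p].
elim: p u => [|x p IH] u /= => [_ <-//|/andP[/eqP<-] pp e].
apply: Pstep; last exact: IH pp e.
by rewrite inE; apply/connectP; exists p.
Qed.

Section Tree.
Variables (V : finType) (H : rel V) (root : V) (rank : V -> nat).
Variables (par : V -> V) (up : V -> {set V}).
Hypothesis T : tree_order H [set: V] root rank par up.

Lemma up_descendants v u w :
  u \in descendants par v -> w \in up u -> w \in descendants par v \/ w \in up v.
Proof.
move=> uv; move: w; elim/descendants_ind: u / uv => [|u uv IH] w; first by right.
case: (eqVneq u root) => [->|ur]; first by rewrite (up_root T) inE.
move/(subsetP (up_par T (in_setT u) ur)) => /setU1P[->|/IH//].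
by left.
Qed.

Lemma in_up_descendants d e : d \in up e -> e \in descendants par d.
Proof.
have [n] := ubnP (rank e); elim: n e => // n IH e; rewrite ltnS => hr.
case: (eqVneq e root) => [->|er]; first by rewrite (up_root T) inE.
move/(subsetP (up_par T (in_setT e) er)) => /setU1P[->|h].
  by rewrite inE; apply: fconnect1.
apply: par_descendants; apply: IH h.
by apply: leq_trans hr; apply: (rank_par T (in_setT e) er).
Qed.

(** One end of an edge is in the [up] of the other, hence is its ancestor. So an edge leaves a
    subtree only upwards, and then into [up v]. *)
Lemma closed_off_descendants v : closed_off H (descendants par v) (up v).
Proof.
move=> u w uv h.
have [/in_up_descendants wu|] := edge_up T (in_setT u) (in_setT w) h.
  by left; apply: descendants_trans wu uv.
exact: up_descendants.
Qed.

Lemma descendants_root u : u \in descendants par root.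
Proof.
have [n] := ubnP (rank u); elim: n u => // n IH u; rewrite ltnS => hr.
case: (eqVneq u root) => [->|ur]; first by rewrite inE connect0.
apply: par_descendants; apply: IH.
by apply: leq_trans hr; apply: (rank_par T (in_setT u) ur).
Qed.

(* A deepest vertex with more than half of [W] below it; a group of subtrees
   hanging from it is then balanced. *)
Lemma balanced_separator (W : {set V}) : 1 < #|W| ->
  exists S X : {set V}, [/\ #|S| <= 3,
    forall u w, u \in X -> w \notin X -> H u w -> w \in S,
    4 * #|W :&: X| <= 3 * #|W| & 4 * #|W :\: X| <= 3 * #|W|].
Proof.
move=> W1; pose heavy v := #|W| < 2 * #|W :&: descendants par v|.
have hroot : heavy root.
  rewrite /heavy (_ : W :&: _ = W); first by lia.
  by apply/setIidPl/subsetP => u _; apply: descendants_root.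
case: (arg_maxnP rank hroot) => v hv vmax.
pose Ch := [set c | (c != root) && (par c == v)].
pose U (Q : {set V}) := \bigcup_(c in Q) descendants par c.
have light c : c \in Ch -> 2 * #|W :&: descendants par c| <= #|W|.
  rewrite inE => /andP[cr /eqP pc]; rewrite leqNgt; apply/negP => /vmax.
  by rewrite /= leqNgt -pc (rank_par T (in_setT c) cr).
have dv u : u \in descendants par v -> u \in v |: U Ch.
  move=> uv; elim/descendants_ind: u / uv => [|u uv]; first by rewrite !inE eqxx.
  case: (eqVneq u root) => [->|ur]; first by rewrite (par_root T).
  case/setU1P => [pu|/bigcupP[c cC uc]].
    apply/setU1r/bigcupP; exists u; first by rewrite inE ur pu eqxx.
    by rewrite inE connect0.
  by apply/setU1r/bigcupP; exists c => //; apply: par_descendants.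
pose big (Q : {set V}) := (Q \subset Ch) && (#|W| <= 4 * #|W :&: U Q|).
(* The subtrees of the children miss only [v] among the more than [#|W| / 2] vertices below it;
   since [1 < #|W|], at least a quarter of [W] is left. *)
have bigCh : big Ch.
  rewrite /big subxx /=.
  have : #|W :&: descendants par v| <= 1 + #|W :&: U Ch|.
    rewrite -(cards1 v); apply: leq_trans (leq_card_setU _ _).
    apply/subset_leq_card/subsetP => u /setIP[uW /dv /setU1P[->|h]].
      by rewrite !inE eqxx.
    by apply/setUP; right; apply/setIP.
  by move: hv; rewrite /heavy; clear -W1; lia.
(* By minimality [Q] without [c] covers less than a quarter, and the light subtree of [c] adds at
   most a half: together at most three quarters. *)
have [Q /minsetP[/andP[QC bQ] Qmin] _] := minset_exists bigCh.
have /set0Pn[c cQ] : Q != set0.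
  apply: contraTneq bQ => ->; rewrite /U big_set0 setI0 cards0.
  by rewrite -ltnNge muln0 ltnW.
exists (v |: up v), (U Q); split.
- rewrite cardsU1; have := card_up T (in_setT v); clear; case: (_ \notin _); lia.
- move=> u w /bigcupP[a aQ ua] wX h.
  have /setIdP[ar /eqP pa] : a \in Ch by apply: (subsetP QC).
  have [wa|wa] := closed_off_descendants ua h.
    by case/negP: wX; apply/bigcupP; exists a.
  by have := subsetP (up_par T (in_setT a) ar) _ wa; rewrite pa.
- have hlt : 4 * #|W :&: U (Q :\ c)| < #|W|.
    rewrite ltnNge; apply/negP => h.
    have e : Q :\ c = Q.
      apply: Qmin; last exact: subD1set.
      by rewrite /big (subset_trans (subD1set _ _) QC).
    by move: cQ; rewrite -e !inE eqxx.
  have hl := light c (subsetP QC c cQ).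
  have : #|W :&: U Q| <= #|W :&: U (Q :\ c)| + #|W :&: descendants par c|.
    apply: leq_trans (leq_card_setU _ _).
    apply/subset_leq_card/subsetP => u /setIP[uW /bigcupP[a aQ ua]].
    case: (eqVneq a c) => [<-|ac]; first by apply/setUP; right; apply/setIP.
    apply/setUP; left; apply/setIP; split=> //; apply/bigcupP; exists a => //.
    by rewrite !inE ac.
  clear -hlt hl; lia.
- have := cardsID (U Q) W; clear -bQ; lia.
Qed.

(** Each of the [h] rounds shrinks the sets by a factor 3/4 and adds at most three boundary
    vertices, which become singleton pieces. A split adds at most four pieces, and [4 * m] is
    charged to the more than [m] vertices being split; sets of one round are disjoint, so a round
    costs at most [4 * #|W|]. Keeping [B \subset p.2] ensures that boundaries stay nonempty. *)
Lemma decomposition (m h : nat) (W B : {set V}) : symmetric H ->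
  0 < m -> closed_off H W B -> 3 ^ h * #|W| <= 4 ^ h * m ->
  exists ps : seq ({set V} * {set V}),
    [/\ forall p, p \in ps -> p.2 \subset W :|: B,
        forall p, p \in ps -> (exists c, p = ([set c], [set c])) \/
          [/\ closed_off H p.1 p.2, B \subset p.2, #|p.1| <= m
            & #|p.2| <= #|B| + 3 * h],
        forall x, x \in W -> exists2 p, p \in ps & x \in p.1
      & size ps * m <= m + 4 * h * #|W|].
Proof.
move=> sH m0; elim: h W B => [|h IH] W B cWB hW.
  rewrite !expn0 !mul1n in hW.
  exists [:: (W, B)]; split.
  - by move=> p; rewrite inE => /eqP->; apply: subsetUr.
  - by move=> p; rewrite inE => /eqP-> /=; right; split=> //; apply: leq_addr.
  - by move=> x xW; exists (W, B); rewrite ?inE ?eqxx.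
  - by rewrite mul1n leq_addr.
case: (leqP #|W| m) => Wm.
  exists [:: (W, B)]; split.
  - by move=> p; rewrite inE => /eqP->; apply: subsetUr.
  - by move=> p; rewrite inE => /eqP-> /=; right; split=> //; apply: leq_addr.
  - by move=> x xW; exists (W, B); rewrite ?inE ?eqxx.
  - by rewrite mul1n leq_addr.
have W1 : 1 < #|W| by apply: leq_trans Wm.
have [S [X [cS XS hX hX']]] := balanced_separator W1.
pose B' := B :|: (S :&: W).
have cB' : #|B'| + 3 * h <= #|B| + 3 * h.+1.
  have : #|B'| <= #|B| + #|S :&: W| by apply: leq_card_setU.
  by have := subset_leq_card (subsetIl S W); clear -cS; lia.
pose W1' := (W :&: X) :\: S; pose W2' := (W :\: X) :\: S.
have c1 : closed_off H W1' B'.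
  move=> u w /setDP[/setIP[uW uX] uS] huw.
  have [wW|wB] := cWB u w uW huw; last by right; rewrite inE wB.
  case: (boolP (w \in S)) => wS; first by right; rewrite !inE wS wW orbT.
  case: (boolP (w \in X)) => wX; first by left; rewrite !inE wS wW wX.
  by rewrite (XS u w) in wS.
have c2 : closed_off H W2' B'.
  move=> u w /setDP[/setDP[uW uX] uS] huw.
  have [wW|wB] := cWB u w uW huw; last by right; rewrite inE wB.
  case: (boolP (w \in S)) => wS; first by right; rewrite !inE wS wW orbT.
  case: (boolP (w \in X)) => wX; last by left; rewrite !inE wS wW wX.
  by move: uS; rewrite (XS w u wX uX) // sH.
have l1 := subset_leq_card (subsetDl (W :&: X) S).
have l2 := subset_leq_card (subsetDl (W :\: X) S).
have e1 : 3 ^ h * #|W1'| <= 4 ^ h * m.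
  by move: hW hX l1; rewrite -/W1' !expnS; clear; nia.
have e2 : 3 ^ h * #|W2'| <= 4 ^ h * m.
  by move: hW hX' l2; rewrite -/W2' !expnS; clear; nia.
have [ps1 [ps1B ps1P ps1W ps1s]] := IH W1' B' c1 e1.
have [ps2 [ps2B ps2P ps2W ps2s]] := IH W2' B' c2 e2.
pose sg := [seq ([set c], [set c]) | c <- enum (S :&: W)].
have BW : forall Z : {set V}, Z \subset W -> Z :|: B' \subset W :|: B.
  move=> Z /subsetP ZW; apply/subsetP => x; rewrite !inE.
  by case/orP => [/ZW->//|/orP[->|/andP[_ ->]]]; rewrite ?orbT.
have W1W : W1' \subset W by apply/subsetP => x; rewrite !inE => /and3P[].
have W2W : W2' \subset W by apply/subsetP => x; rewrite !inE => /and3P[].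
have memsg p : p \in sg -> exists2 c, c \in W & p = ([set c], [set c]).
  by case/mapP => c; rewrite mem_enum => /setIP[_ cW] ->; exists c.
exists (ps1 ++ ps2 ++ sg); split.
- move=> p; rewrite !mem_cat => /or3P[/ps1B|/ps2B|/memsg[c cW ->]].
  + by move/subset_trans; apply; apply: BW.
  + by move/subset_trans; apply; apply: BW.
  + by rewrite sub1set inE cW.
- have BB' : B \subset B' by apply: subsetUl.
  move=> p; rewrite !mem_cat => /or3P[/ps1P|/ps2P|/memsg[c cW ->]].
  + case=> [|[h1 h2 h3 h4]]; [by left|right; split=> //].
      exact: subset_trans BB' h2.
    exact: leq_trans h4 cB'.
  + case=> [|[h1 h2 h3 h4]]; [by left|right; split=> //].
      exact: subset_trans BB' h2.
    exact: leq_trans h4 cB'.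
  + by left; exists c.
- move=> x xW; case: (boolP (x \in S)) => xS.
    exists ([set x], [set x]); last by rewrite inE.
    by rewrite !mem_cat (map_f (fun c => ([set c], [set c]))) ?orbT // mem_enum inE xS.
  case: (boolP (x \in X)) => xX.
    have [|p pp xp] := ps1W x; first by rewrite !inE xS xW xX.
    by exists p; rewrite // mem_cat pp.
  have [|p pp xp] := ps2W x; first by rewrite !inE xS xW xX.
  by exists p; rewrite // !mem_cat pp orbT.
- have szs : size sg <= 3.
    rewrite size_map -cardE; apply: leq_trans cS.
    exact: subset_leq_card (subsetIl _ _).
  have WW : #|W1'| + #|W2'| <= #|W|.
    by rewrite -(cardsID X W); apply: leq_add.
  rewrite !size_cat; move: ps1s ps2s szs WW Wm; clear.
  move: #|W1'| #|W2'| #|W| (size ps1) (size ps2) (size sg) => a b c s1 s2 s3.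
  nia.
Qed.

End Tree.
End Separators.

(** * Trips, excursions and the recursion over the scales *)

Section Exploration.
Import mathcomp.boot.fintype mathcomp.boot.finset.

Section Trips.
Variables (V : finType) (A : nat -> rel V).

(* [trip t t' x y S]: one can be at [x] just before snapshot [t], at [y] just
   before snapshot [t'], and visit exactly [S] in between; waiting is allowed. *)
Inductive trip : nat -> nat -> V -> V -> {set V} -> Prop :=
| trip_nil t x : trip t t x x [set x]
| trip_wait t t' x y S : trip t t' x y S -> trip t t'.+1 x y S
| trip_move t t' x y z S :
    trip t t' x y S -> A t' y z -> trip t t'.+1 x z (z |: S).

Lemma trip_end t t' x y S : trip t t' x y S -> y \in S.
Proof. by elim=> {t t' x y S} *; rewrite ?inE ?eqxx. Qed.

Lemma trip_cat t1 t2 t3 x y z S S' :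
  trip t1 t2 x y S -> trip t2 t3 y z S' -> trip t1 t3 x z (S :|: S').
Proof.
move=> h1 h2; elim: h2 h1 => {t2 t3 y z S'} [t y|t t' y z S' _ IH|t t' y z w S' _ IH h] h1.
- have /setUidPl-> // : [set y] \subset S by rewrite sub1set (trip_end h1).
- exact/trip_wait/IH.
- by rewrite setUCA; apply: trip_move h; apply: IH.
Qed.

Lemma trip_stay t t' x : t <= t' -> trip t t' x x [set x].
Proof.
elim: t' => [|t' IH]; first by rewrite leqn0 => /eqP->; apply: trip_nil.
rewrite leq_eqVlt => /predU1P[->|]; first exact: trip_nil.
by rewrite ltnS => /IH; apply: trip_wait.
Qed.

Definition reachable t t' x y : Prop := exists S, trip t t' x y S.

Lemma reachable_refl t t' x : t <= t' -> reachable t t' x x.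
Proof. by move=> h; exists [set x]; apply: trip_stay. Qed.

Lemma reachable_trans t1 t2 t3 x y z :
  reachable t1 t2 x y -> reachable t2 t3 y z -> reachable t1 t3 x z.
Proof. by move=> [S h] [S' h']; exists (S :|: S'); apply: trip_cat h h'. Qed.

Lemma reachable1 t x y : A t x y -> reachable t t.+1 x y.
Proof. by move=> h; exists (y |: [set x]); apply: trip_move h; apply: trip_nil. Qed.

Definition grow (Z : {set V}) (t : nat) (F : {set V}) : {set V} :=
  F :|: [set y in Z | [exists x in F, A t x y]].

Lemma sub_grow Z t (F : {set V}) : F \subset grow Z t F.
Proof. exact: subsetUl. Qed.

Lemma grow_sub (Z F : {set V}) t : F \subset Z -> grow Z t F \subset Z.
Proof.
by move=> FZ; rewrite subUset FZ; apply/subsetP => y; rewrite inE => /andP[].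
Qed.

Lemma in_grow (Z F : {set V}) t x y :
  x \in F -> y \in Z -> A t x y -> y \in grow Z t F.
Proof.
by move=> xF yZ h; rewrite !inE yZ /=; apply/orP; right; apply/exists_inP; exists x.
Qed.

Lemma connected_fixed Z t (F : {set V}) x y : grow Z t F = F -> x \in F ->
  connect (induced (A t) Z) x y -> y \in F.
Proof.
move=> gF xF /connectP[p]; elim: p x xF => [|z p IH] x xF /= => [_ ->//|].
move=> /andP[/and3P[xZ zZ h] pp]; apply: IH pp.
by rewrite -gF; apply: in_grow h.
Qed.

Fixpoint forward Z t u i : {set V} :=
  if i is i'.+1 then grow Z (t + i') (forward Z t u i') else [set u].

(** Time runs backwards: the [i]-th growth step uses snapshot [t - i]. Symmetry of the snapshots
    turns this growth into reachability of [u]. *)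
Fixpoint backward Z t u i : {set V} :=
  if i is i'.+1 then grow Z (t - i) (backward Z t u i') else [set u].

Lemma forward_reachable Z t u i y :
  y \in forward Z t u i -> reachable t (t + i) u y.
Proof.
elim: i y => [|i IH] y /=.
  by rewrite inE => /eqP->; apply: reachable_refl; rewrite addn0.
rewrite !inE addnS => /orP[/IH h|/andP[_ /exists_inP[x /IH h Axy]]].
  exact: reachable_trans h (reachable_refl _ (leqnSn _)).
exact: reachable_trans h (reachable1 Axy).
Qed.

Hypothesis A_sym : forall t, symmetric (A t).

Lemma backward_reachable Z t u i y : i <= t ->
  y \in backward Z t u i -> reachable (t - i) t y u.
Proof.
elim: i y => [|i IH] y it /=.
  by rewrite inE => /eqP->; apply: reachable_refl; rewrite subn0.
have e : t - i = (t - i.+1).+1 by lia.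
rewrite !inE => /orP[/(IH _ (ltnW it)) h|].
  by apply: reachable_trans h; apply: reachable_refl; rewrite e.
move=> /andP[_ /exists_inP[x /(IH _ (ltnW it)) h Axy]].
by apply: reachable_trans h; rewrite e; apply: reachable1; rewrite A_sym.
Qed.

Variable H : rel V.
Hypothesis A_sub : forall t x y, A t x y -> H x y.
Hypothesis A_conn : forall t x y, connect (A t) x y.

(** A path of the whole snapshot towards [B] cannot leave [C] before it first meets [B]. *)
Lemma connect_boundary (C B : {set V}) t u :
  closed_off H C B -> B != set0 -> u \in C :|: B ->
  exists2 p, p \in B & connect (induced (A t) (C :|: B)) u p.
Proof.
move=> cCB /set0Pn[b bB] uZ.
have /connectP[p pp eb] := A_conn t u b; rewrite {}eb in bB.
elim: p u pp uZ bB => [|x p IH] u /=; first by exists u; rewrite ?connect0.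
move=> /andP[h pp] uZ bB.
case: (boolP (u \in B)) => uB; first by exists u; rewrite ?connect0.
have xZ : x \in C :|: B.
  have uC : u \in C by move: uZ; rewrite inE (negbTE uB) orbF.
  by rewrite inE; have [->|->] := cCB _ _ uC (A_sub h); rewrite ?orbT.
have [q qB hq] := IH x pp xZ bB; exists q => //.
by apply: connect_trans hq; apply: connect1; rewrite /induced /= uZ xZ.
Qed.

(* The sets reached from [u] since [t] and from which [u] can still be reached
   by [t + l] change at most [2 |C :|: B|] times in total, so at some snapshot
   both are unions of components, and these contain a boundary vertex. *)
Lemma travel (C B : {set V}) t l u :
  closed_off H C B -> B != set0 -> u \in C :|: B -> 2 * #|C :|: B| <= l ->
  exists2 p, p \in B & reachable t (t + l) u p /\ reachable t (t + l) p u.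
Proof.
move=> cCB B0; set Z := C :|: B => uZ hl.
pose F i := forward Z t u i; pose G i := backward Z (t + l) u i.
have FZ i : F i \subset Z.
  by elim: i => [|i IH]; [rewrite sub1set|apply: grow_sub].
have GZ i : G i \subset Z.
  by elim: i => [|i IH]; [rewrite sub1set|apply: grow_sub].
have uF i : u \in F i.
  by elim: i => [|i IH]; [rewrite inE|apply: (subsetP (sub_grow _ _ _))].
have uG i : u \in G i.
  by elim: i => [|i IH]; [rewrite inE|apply: (subsetP (sub_grow _ _ _))].
have [i il [Fi Gi]] : exists2 i, i < l & F i.+1 = F i /\ G (l - i) = G (l - i.+1).
  apply: contrapT => no.
  (* If one of the two sets changes at every snapshot, [#|F i| - #|G (l - i)|] gains at least one
     per step, which at [i = l] contradicts [2 * #|Z| <= l]. *)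
  have : forall i, i <= l -> i + #|G (l - i)| <= #|F i| + #|G l|.
    elim=> [|i IH] il; first by rewrite subn0 leq_addl.
    have hi := IH (ltnW il).
    have e : l - i = (l - i.+1).+1 by lia.
    have lF : #|F i| <= #|F i.+1| by apply/subset_leq_card/sub_grow.
    have lG : #|G (l - i.+1)| <= #|G (l - i)|.
      by rewrite e; apply/subset_leq_card/sub_grow.
    case: (ltngtP #|F i| #|F i.+1|) lF => // hF _; first by clear -hi hF lG; lia.
    case: (ltngtP #|G (l - i.+1)| #|G (l - i)|) lG => // hG _.
      by clear -hi hF hG; lia.
    case: no; exists i => //; split; apply/esym/eqP; rewrite eqEcard.
      by rewrite sub_grow hF /=.
    by rewrite hG leqnn andbT e sub_grow.
  move=> /(_ l (leqnn _)); rewrite subnn cards1.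
  have := subset_leq_card (FZ l); have := subset_leq_card (GZ l).
  by clear -hl; lia.
(* Both equalities concern snapshot [t + i]: the last growth step of [G (l - i)] uses
   [t + l - (l - i)]. *)
have [p pB hp] := connect_boundary (t + i) cCB B0 uZ.
exists p => //; split.
  have pF : p \in F i by apply: connected_fixed (uF i) hp.
  apply: reachable_trans (forward_reachable pF) (reachable_refl _ _).
  by rewrite leq_add2l ltnW.
have pG : p \in G (l - i.+1).
  have e : l - i = (l - i.+1).+1 by lia.
  apply: connected_fixed (uG (l - i.+1)) hp.
  rewrite -[RHS]Gi e /G /=; congr grow; lia.
have ti : l - i.+1 <= t + l by lia.
apply: reachable_trans (backward_reachable ti pG); apply: reachable_refl; lia.
Qed.

(** The target [U] is arbitrary so that an excursion can be aimed at what is still unvisited; the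
    price is that [b] depends on [t] and [U]. *)
Definition excursion (D B : {set V}) (L q : nat) : Prop :=
  forall t (U : {set V}), U \subset D ->
  exists2 b, b \in B & exists2 X, trip t (t + L) b b X & #|U| <= q * #|U :&: X|.

Lemma excursion_le D B L q L' q' : L <= L' -> q <= q' ->
  excursion D B L q -> excursion D B L' q'.
Proof.
move=> hL hq E t U UD; have [b bB [X hX hU]] := E t U UD; exists b => //.
exists (X :|: [set b]).
  by apply: trip_cat hX (trip_stay _ _); rewrite leq_add2l.
apply: leq_trans hU (leq_mul hq _).
by apply/subset_leq_card/setIS/subsetUl.
Qed.

Lemma excursion1 c L q : 0 < q -> excursion [set c] [set c] L q.
Proof.
move=> q0 t U Uc; exists c; first by rewrite inE.
exists [set c]; first by apply: trip_stay; rewrite leq_addr.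
by have /setIidPl-> := Uc; rewrite leq_pmull.
Qed.

(** Imagine one agent at every vertex of [B]. In each round the excursion aimed at the uncovered
    part of [U] moves only the agent at its base. While less than half of [U] is covered, a round
    covers at least [#|U| / (2 * q)] new vertices, so [q] rounds cover half of [U]; the best single
    agent has a share of at least [1 / #|B|] of this. *)
Lemma excursion_repeat D B L q : B != set0 -> 0 < q -> excursion D B L q ->
  excursion D B (q * L) (2 * #|B|).
Proof.
move=> /set0Pn[b0 b0B] q0 E t U UD.
have rounds r : exists X : V -> {set V},
    {in B, forall b, trip t (t + r * L) b b (X b)} /\
    (#|U| <= 2 * #|U :&: \bigcup_(b in B) X b| \/
     r * #|U| <= 2 * q * #|U :&: \bigcup_(b in B) X b|).
  elim: r => [|r [X [hX hU]]].
    exists (fun b => [set b]); split; last by right.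
    by move=> b _; rewrite mul0n addn0; apply: trip_nil.
  pose cov := \bigcup_(b in B) X b; pose U' := U :\: cov.
  have U'D : U' \subset D by apply: subset_trans (subsetDl _ _) UD.
  have [b bB [Y hY hU']] := E (t + r * L) U' U'D.
  pose X' a := X a :|: (if a == b then Y else [set a]).
  exists X'; split.
    move=> a aB; rewrite /X' mulSnr addnA; apply: trip_cat (hX a aB) _.
    by case: eqVneq => [->//|_]; apply: trip_stay; rewrite leq_addr.
  set cov' := \bigcup_(a in B) X' a.
  have : #|U :&: cov| + #|U' :&: Y| <= #|U :&: cov'|.
    have <- : #|(U :&: cov) :|: (U' :&: Y)| = #|U :&: cov| + #|U' :&: Y|.
      apply/eqP; rewrite (leq_card_setU _ _).2 disjoints_subset.
      by apply/subsetP => x; rewrite !inE => /andP[-> ->].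
    apply/subset_leq_card/subsetP => x.
    rewrite !inE => /orP[/andP[-> /bigcupP[a aB xa]]|/andP[/andP[_ ->] xY]].
      by apply/bigcupP; exists a => //; rewrite inE xa.
    by apply/bigcupP; exists b => //; rewrite inE eqxx xY orbT.
  have := cardsID cov U; rewrite -/U'; move: hU hU'; rewrite -/cov.
  move: #|U :&: cov| #|U' :&: Y| #|U'| #|U| #|U :&: cov'|.
  clear -q0 => a b' c d e.
  case=> [h1|h1] h2 h3 h4; first by left; lia.
  case: (leqP d (2 * a)) => h5; first by left; lia.
  by right; nia.
have [X [hX hU]] := rounds q.
have {}hU : #|U| <= 2 * #|U :&: \bigcup_(b in B) X b|.
  case: hU => //; rewrite -mulnA mulnCA leq_pmul2l //.
have [b bB hb] : exists2 b, b \in B &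
    #|U :&: \bigcup_(b in B) X b| <= #|B| * #|U :&: X b|.
  case: (arg_maxnP (fun b => #|U :&: X b|) b0B) => b bB bmax.
  exists b => //; rewrite -sum_nat_const.
  apply: (@leq_trans (\sum_(a in B) #|U :&: X a|)); last first.
    by apply: leq_sum => a aB; apply: bmax.
  rewrite big_distrr /=.
  elim/big_rec2: _ => [|a n Y aB]; first by rewrite cards0.
  by move=> h; apply: leq_trans (leq_card_setU _ _) _; rewrite leq_add2l.
exists b => //; exists (X b); first exact: hX.
by apply: leq_trans hU _; rewrite -mulnA leq_mul2l.
Qed.

Lemma card_cover_seq (U : {set V}) (ps : seq ({set V} * {set V})) :
  (forall x, x \in U -> exists2 p, p \in ps & x \in p.1) ->
  #|U| <= \sum_(p <- ps) #|U :&: p.1|.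
Proof.
elim: ps U => [|p ps IH] U cov.
  rewrite big_nil leqn0 cards_eq0; apply: contraT => /set0Pn[x /cov[p]].
  by rewrite in_nil.
rewrite big_cons -(cardsID p.1 U) leq_add2l.
apply: leq_trans (IH (U :\: p.1) _) _.
  move=> x /setDP[/cov[q]]; rewrite inE => /predU1P[->|qs] xq xp; last by exists q.
  by rewrite xq in xp.
by apply: leq_sum => q _; apply/subset_leq_card/setSI/subsetDl.
Qed.

Lemma ex_large_term (T : eqType) (s : seq T) (f : T -> nat) n :
  0 < n -> n <= \sum_(x <- s) f x -> exists2 x, x \in s & n <= size s * f x.
Proof.
move=> n0 hn; apply: contrapT => no.
have : size s * \sum_(x <- s) f x <= size s * n.-1.
  rewrite big_distrr /= -[X in _ <= X * _]sum1_size big_distrl /=.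
  rewrite big_seq [X in _ <= X]big_seq; apply: leq_sum => x xs; rewrite mul1n.
  by rewrite -ltnS prednK // ltnNge; apply/negP => h; apply: no; exists x.
case: s hn {no} => [|x s]; first by rewrite big_nil; case: (n) n0.
by rewrite leq_mul2l /= => h1 h2; have := leq_trans h1 h2; case: (n) n0 => // m _; rewrite ltnn.
Qed.

Lemma ex_frequent_value (f : nat -> V) (D : {set V}) M k k' :
  (forall j, j < M -> f j \in D) -> #|D| <= k' -> 0 < M -> k' * k <= M ->
  exists2 c, c \in D & k <= #|[set j : 'I_M | f j == c]|.
Proof.
move=> fD Dk M0 hM; apply: contrapT => no.
have lt c : c \in D -> #|[set j : 'I_M | f j == c]| < k.
  by move=> cD; rewrite ltnNge; apply/negP => h; apply: no; exists c.
have : M = \sum_(c in D) #|[set j : 'I_M | f j == c]|.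
  rewrite -[LHS]card_ord -sum1_card (partition_big (fun j : 'I_M => f j) (mem D)).
    by apply: eq_bigr => c _; rewrite -sum1_card; apply: eq_bigl => j; rewrite inE.
  by move=> j _; apply: fD.
move=> e; have f0 := fD 0 M0; have k0 : 0 < k by apply: leq_trans (lt _ f0).
have : M <= #|D| * k.-1.
  rewrite e -sum_nat_const; apply: leq_sum => c /lt; by case: (k) k0.
have D0 : 0 < #|D| by apply/card_gt0P; exists (f 0).
move: hM Dk D0 k0; clear; nia.
Qed.

(* The windows alternate between travelling and staying at some [c] on the
   boundary of a good piece.  Some [c] is used [k] times, and of the [k + 1]
   travelling windows around these stays two pair [c] with the same [p] in
   [B]. *)
Lemma excursion_step (C B : {set V}) (ps : seq ({set V} * {set V}))
    (k k' q l L : nat) :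
  closed_off H C B -> B != set0 -> #|B| <= k -> 2 * #|C :|: B| <= l ->
  (forall p, p \in ps ->
     [/\ p.2 \subset C :|: B, #|p.2| <= k' & excursion p.1 p.2 L q]) ->
  (forall x, x \in C -> exists2 p, p \in ps & x \in p.1) ->
  excursion C B ((k' * k).+1 * (l + L)) (size ps * q).
Proof.
move=> cCB B0 Bk hl psP psC t U UC.
case: (set_0Vmem U) => [->|[x0 x0U]].
  have /set0Pn[b bB] := B0; exists b => //; exists [set b].
    by apply: trip_stay; rewrite leq_addr.
  by rewrite cards0.
have U0 : 0 < #|U| by apply/card_gt0P; exists x0.
have [p pps hp] : exists2 p, p \in ps & #|U| <= size ps * #|U :&: p.1|.
  apply: ex_large_term => //; apply: card_cover_seq => x xU.
  exact/psC/(subsetP UC).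
have [pZ pk' Ep] := psP p pps.
pose M := k' * k; pose P := l + L.
have /choice[bX hbX] : forall j, exists bX : V * {set V},
    [/\ bX.1 \in p.2, trip (t + j * P + l) (t + j * P + l + L) bX.1 bX.1 bX.2
      & #|U :&: p.1| <= q * #|U :&: bX.2|].
  move=> j; have [b bp [X hX hU]] := Ep (t + j * P + l) _ (subsetIr U p.1).
  exists (b, X); split=> //; apply: leq_trans hU _.
  by rewrite leq_mul2l subset_leq_card ?orbT // setSI // subsetIl.
have k0 : 0 < k.
  by have /set0Pn[b bB] := B0; apply: leq_trans Bk; apply/card_gt0P; exists b.
have k'0 : 0 < k'.
  by apply: leq_trans pk'; apply/card_gt0P; exists (bX 0).1; case: (hbX 0).
have M0 : 0 < M by rewrite muln_gt0 k'0.
have [c cp kc] : exists2 c, c \in p.2 & k <= #|[set j : 'I_M | (bX j).1 == c]|.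
  apply: (ex_frequent_value (f := fun j => (bX j).1) (k' := k')) => // j _.
  by case: (hbX j).
have cZ : c \in C :|: B by apply: (subsetP pZ).
have /choice[f hf] : forall j, exists b, b \in B /\
    (reachable (t + j * P) (t + j * P + l) c b /\
     reachable (t + j * P) (t + j * P + l) b c).
  by move=> j; have [b bB hb] := travel (t + j * P) cCB B0 cZ hl; exists b.
(* The index [M] is the travelling window after the last stay; it explains the successor in
   [(k' * k).+1]. *)
pose D := [set j : 'I_M.+1 | (j == M :> nat) || ((bX j).1 == c)].
have cD : k < #|D|.
  have mD : ord_max \in D by rewrite inE /= eqxx.
  rewrite (cardsD1 ord_max) mD add1n ltnS; apply: leq_trans kc _.
  rewrite -(card_imset _ (@lift_inj _ ord_max)).
  apply/subset_leq_card/subsetP => _ /imsetP[j jc ->].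
  have e : lift ord_max j = j :> nat by rewrite /= /bump leqNgt ltn_ord.
  rewrite inE in jc; rewrite !inE e jc orbT andbT.
  by rewrite eq_sym neq_lift.
have [j [j' [jj' jD j'D fjj']]] : exists j j' : 'I_M.+1,
    [/\ j < j', j \in D, j' \in D & f j = f j'].
  apply: contrapT => no.
  have inj : {in D &, injective (fun j : 'I_M.+1 => f j)}.
    move=> j j' jD j'D e; apply/val_inj.
    by case: (ltngtP j j') => // h; case: no; [exists j, j'|exists j', j].
  move: cD; rewrite ltnNge => /negP; apply.
  rewrite -(card_in_imset inj); apply: leq_trans Bk.
  by apply/subset_leq_card/subsetP => _ /imsetP[j _ ->]; case: (hf j).
have jM : j < M by rewrite (leq_trans jj') // -ltnS.
have {jD}bj : (bX j).1 = c.
  by move: jD; rewrite inE => /orP[/eqP e|/eqP//]; rewrite e ltnn in jM.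
have [_ hX hUX] := hbX j; rewrite bj in hX.
have [fB [_ [S1 h1]]] := hf j; have [_ [[S2 h2] _]] := hf j'.
rewrite -fjj' in h2.
exists (f j) => //.
have s0 : trip t (t + j * P) (f j) (f j) [set f j].
  by apply: trip_stay; rewrite leq_addr.
have s1 : trip (t + j * P + l + L) (t + j' * P) c c [set c].
  apply: trip_stay; rewrite -!addnA -/P leq_add2l addnC -mulSn leq_mul2r.
  by rewrite jj' orbT.
have s2 : trip (t + j' * P + l) (t + M.+1 * P) (f j) (f j) [set f j].
  apply: trip_stay; have : j' <= M by rewrite -ltnS.
  by rewrite /P; clear; nia.
(* Wait at [f j], travel to [c] in window [j], make the excursion, wait at [c] until window [j'],
   travel back, wait. *)
have all := trip_cat s0 (trip_cat h1 (trip_cat hX (trip_cat s1 (trip_cat h2 s2)))).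
eexists; first exact: all.
apply: leq_trans hp _; rewrite -mulnA leq_mul2l; apply/orP; right.
apply: leq_trans hUX _; rewrite leq_mul2l; apply/orP; right.
apply/subset_leq_card/setIS/subsetP => x xX.
by rewrite !inE xX !orbT.
Qed.

(** With the single base [s], the repeated excursions concatenate, and each at least halves the
    unvisited set. *)
Lemma explore_all s L q : 0 < q -> excursion [set: V] [set s] L q ->
  forall r, #|V| < 2 ^ r -> trip 0 (r * (q * L)) s s [set: V].
Proof.
move=> q0 E r Vr.
have {q0}E : excursion [set: V] [set s] (q * L) 2.
  have s0 : [set s] != set0 by apply/set0Pn; exists s; rewrite inE.
  by have := excursion_repeat s0 q0 E; rewrite cards1 muln1.
have [X hX hr] : exists2 X, trip 0 (r * (q * L)) s s X & 2 ^ r * #|~: X| <= #|V|.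
  elim: r {Vr} => [|r [X hX hr]].
    exists [set s]; first by rewrite mul0n; apply: trip_nil.
    by rewrite expn0 mul1n max_card.
  have [_ /set1P-> [Y hY hU]] := E (0 + r * (q * L)) (~: X) (subsetT _).
  exists (X :|: Y); first by rewrite mulSnr; apply: trip_cat hX hY.
  rewrite setCU expnSr -mulnA; apply: leq_trans hr; rewrite leq_mul2l.
  apply/orP; right; have := cardsID Y (~: X); rewrite setDE; clear -hU; lia.
suff -> : [set: V] = X by [].
apply/esym/eqP; rewrite eqEsubset subsetT /= -setCS setCT subset0 -cards_eq0.
by rewrite -leqn0 leqNgt; apply/negP => h; move: hr Vr h; clear; nia.
Qed.

(** [K] bounds all boundary sizes, [h] is the number of splitting rounds per scale and [x] the ratio
    of scales. There are at most [(4 * h * x).+1] pieces, each visited up to a fraction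
    [1 / (2 * K)], whence the number of repetitions. [(K * K).+1] counts the periods of
    [excursion_step], each a travelling window followed by a stay. *)
Fixpoint level_time (K h x i : nat) : nat :=
  if i is i'.+1 then
    (4 * h * x).+1 * (2 * K) *
      ((K * K).+1 * (2 * (x ^ i + K) + level_time K h x i'))
  else (K * K).+1 * (2 * K.+1).

Variables (root : V) (rank : V -> nat) (par : V -> V) (up : V -> {set V}).
Hypothesis H_sym : symmetric H.
Hypothesis T : tree_order H [set: V] root rank par up.

Lemma level_excursion (K h x i : nat) (C B : {set V}) :
  0 < x -> 3 ^ h * x <= 4 ^ h -> closed_off H C B -> B != set0 ->
  #|B| + 3 * h * i <= K -> #|C| <= x ^ i ->
  excursion C B (level_time K h x i) (2 * K).
Proof.
move=> x0 hx; elim: i C B => [|i IH] C B cCB B0 BK Cx.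
  have BK' : #|B| <= K by apply: leq_trans BK; apply: leq_addr.
  have K0 : 0 < K by apply: leq_trans BK'; rewrite card_gt0.
  pose ps := [seq ([set c], [set c]) | c <- enum C].
  (* At scale 0 there is at most one vertex to visit, and reaching it is enough: stays have length
     0. *)
  have /= := @excursion_step C B ps K K 1 (2 * K.+1) 0 cCB B0 BK'.
  rewrite addn0 => E; apply: excursion_le (E _ _ _) => //.
  - rewrite size_map -cardE muln1; apply: leq_trans Cx _.
    by rewrite expn0 muln_gt0.
  - have : #|C :|: B| <= #|C| + #|B| by apply: leq_card_setU.
    by move: Cx; rewrite expn0; clear -BK'; lia.
  - move=> p /mapP[c]; rewrite mem_enum => cC ->; split=> /=.
    + by rewrite sub1set inE cC.
    + by rewrite cards1.
    + exact: excursion1.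
  - move=> c cC; exists ([set c], [set c]); last by rewrite inE.
    by apply: (map_f (fun c => ([set c], [set c]))); rewrite mem_enum.
have BK' : #|B| <= K by apply: leq_trans BK; apply: leq_addr.
have K0 : 0 < K by apply: leq_trans BK'; rewrite card_gt0.
have m0 : 0 < x ^ i by rewrite expn_gt0 x0.
have hC : 3 ^ h * #|C| <= 4 ^ h * x ^ i.
  apply: (@leq_trans (3 ^ h * x ^ i.+1)); first by rewrite leq_mul2l Cx orbT.
  by rewrite expnS mulnA leq_mul2r hx orbT.
have [ps [psB psP psC szps]] := decomposition T H_sym m0 cCB hC.
have {}szps : size ps <= (4 * h * x).+1.
  rewrite -(leq_pmul2r m0); apply: leq_trans szps _.
  by move: Cx; rewrite expnS; clear; nia.
have E : excursion C B ((K * K).+1 * (2 * (x ^ i.+1 + K) + level_time K h x i))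
    (size ps * (2 * K)).
  apply: excursion_step => //.
  - have : #|C :|: B| <= #|C| + #|B| by apply: leq_card_setU.
    by clear -BK' Cx; lia.
  - move=> p pps; case: (psP p pps) => [[c e]|[cp Bp p1 p2]].
      move: (psB p pps); rewrite e /= => ->; split=> //; first by rewrite cards1.
      by apply: excursion1; rewrite muln_gt0.
    split; first exact: psB.
      by apply: leq_trans p2 _; move: BK; clear; lia.
    apply: IH => //; last by move: BK p2; clear; lia.
    by apply: contraNneq B0 => e; rewrite e subset0 in Bp.
have {}E : excursion C B ((K * K).+1 * (2 * (x ^ i.+1 + K) + level_time K h x i))
    ((4 * h * x).+1 * (2 * K)).
  by apply: excursion_le E => //; rewrite leq_mul2r szps orbT.
have q0 : 0 < (4 * h * x).+1 * (2 * K) by rewrite !muln_gt0.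
by apply: excursion_le (excursion_repeat B0 q0 E) => //; rewrite leq_mul2l BK' orbT.
Qed.

Theorem exploration (K h x i r : nat) (s : V) :
  0 < x -> 3 ^ h * x <= 4 ^ h -> 1 + 3 * h * i <= K -> #|V| <= x ^ i ->
  #|V| < 2 ^ r ->
  trip 0 (r * (2 * K * level_time K h x i)) s s [set: V].
Proof.
move=> x0 hx hK hV hr; apply: explore_all => //.
  by rewrite muln_gt0 /=; apply: leq_trans hK.
apply: level_excursion => //.
- by move=> u w _ _; left; rewrite inE.
- by apply/set0Pn; exists s; rewrite inE.
- by rewrite cards1.
- by rewrite cardsT.
Qed.

End Trips.
End Exploration.

(** * Crossing parities of finite chains of points *)

Section CrossingParity.
Variable R : realType.
Local Open Scope ring_scope.
Implicit Types (z w a b : R * R) (s f : seq (R * R)) (e : R).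

Definition near_pts e z w : bool := (`|z.1 - w.1| < e) && (`|z.2 - w.2| < e).

Definition lex_lt z w : bool := (z.1 < w.1) || ((z.1 == w.1) && (z.2 < w.2)).

Definition higher z w : bool := w.2 < z.2.

(* Parity of the number of steps of the polygon [z :: s] across the vertical
   ray above [w]; ties are broken by tilting the ray slightly. *)
Fixpoint cross z s w : bool :=
  if s is z' :: s' then
    ((lex_lt z w (+) lex_lt z' w) && higher z w) (+) cross z' s' w
  else false.

(** Parity of the steps of the chain [w :: f] across the vertical ray below [z]. *)
Fixpoint cross_below w f z : bool :=
  if f is w' :: f' then
    ((lex_lt z w (+) lex_lt z w') && higher z w) (+) cross_below w' f' z
  else false.

Definition far_pts e z w : bool := ~~ near_pts (4 * e) z w.

Lemma lex_ltT z w : z.1 < w.1 -> lex_lt z w = true.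
Proof. by rewrite /lex_lt => ->. Qed.

Lemma lex_ltF z w : w.1 < z.1 -> lex_lt z w = false.
Proof. by move=> h; rewrite /lex_lt (lt_gtF h) (gt_eqF h). Qed.

Lemma higherT z w : w.2 < z.2 -> higher z w = true.
Proof. by []. Qed.

Lemma higherF z w : z.2 < w.2 -> higher z w = false.
Proof. exact: lt_gtF. Qed.

(** Far points differ by at least [4 * e] in one coordinate; moving each by less than [e] keeps
    their order in that coordinate. *)
Lemma square_const e z z' w w' :
  far_pts e z w -> near_pts e z z' -> near_pts e w w' ->
  [/\ lex_lt z w = lex_lt z' w, lex_lt z w = lex_lt z w' & lex_lt z w = lex_lt z' w']
  \/ [/\ higher z w = higher z' w, higher z w = higher z w' & higher z w = higher z' w'].
Proof.
rewrite /far_pts /near_pts negb_and -!leNgt !ltr_norml.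
move=> h /andP[/andP[h1 h2] /andP[h3 h4]] /andP[/andP[h5 h6] /andP[h7 h8]].
case/orP: h; rewrite ler_normr => /orP[] h.
- by left; rewrite !lex_ltF //; lra.
- by left; rewrite !lex_ltT //; lra.
- by right; rewrite !higherT //; lra.
- by right; rewrite !higherF //; lra.
Qed.

(** A discrete cocycle identity: summed over all squares formed by a step of one chain and a step of
    the other, only boundary terms survive. *)
Lemma square_sum e z z' w w' :
  far_pts e z w -> near_pts e z z' -> near_pts e w w' ->
  ((lex_lt z w (+) lex_lt z' w) && higher z w) (+)
  ((lex_lt z w' (+) lex_lt z' w') && higher z w') (+)
  (((lex_lt z w (+) lex_lt z w') && higher z w) (+)
   ((lex_lt z' w (+) lex_lt z' w') && higher z' w)) = false.
Proof.
move=> h1 h2 h3; have [[<- <- <-]|[<- <- _]] := square_const h1 h2 h3.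
  by rewrite !addbb.
by case: (higher z w); rewrite ?andbT ?andbF //;
  case: (lex_lt z w); case: (lex_lt z' w); case: (lex_lt z w'); case: (lex_lt z' w').
Qed.

Definition far_seqs e s f : bool := all (fun z => all (far_pts e z) f) s.

Lemma strip_sum e z s w w' :
  path (near_pts e) z s -> near_pts e w w' -> all (far_pts e ^~ w) (z :: s) ->
  cross z s w (+) cross z s w' =
  ((lex_lt z w (+) lex_lt z w') && higher z w) (+)
  ((lex_lt (last z s) w (+) lex_lt (last z s) w') && higher (last z s) w).
Proof.
move=> + ww'; elim: s z => [|z' s IH] z /=; first by rewrite addbb.
move=> /andP[zz' ps] /andP[fz fs].
have := square_sum fz zz' ww'; have := IH z' ps fs.
move: (cross _ _ _) (cross _ _ _) => a b.
move: (_ && _) => c; move: (_ && _) => d; move: (_ && _) => f1.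
move: (_ && _) => f2; move: (_ && _) => f3.
by case: a; case: b; case: c; case: d; case: f1; case: f2; case: f3.
Qed.

Lemma cross_sum e z s w f :
  path (near_pts e) z s -> path (near_pts e) w f ->
  far_seqs e (z :: s) (w :: f) ->
  cross z s w (+) cross z s (last w f) =
  cross_below w f z (+) cross_below w f (last z s).
Proof.
move=> ps; elim: f w => [|w' f IH] w; first by rewrite /= addbb.
case/andP => ww' pf far.
have far1 : all (far_pts e ^~ w) (z :: s).
  by apply/allP => x /(allP far) /andP[].
have far2 : far_seqs e (z :: s) (w' :: f).
  by apply/allP => x /(allP far) /andP[].
rewrite /=; have := IH w' pf far2; have := strip_sum ps ww' far1.
move: (cross z s w) (cross z s w') (cross z s (last w' f)) => a b c.
move: (_ && _) => d1; move: (_ && _) => d2.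
move: (cross_below w' f z) (cross_below w' f (last z s)) => g1 g2.
by case: a; case: b; case: c; case: d1; case: d2; case: g1; case: g2.
Qed.

Lemma near_pts_sym e z w : near_pts e z w = near_pts e w z.
Proof. by rewrite /near_pts -[z.1 - _]opprB -[z.2 - _]opprB !normrN. Qed.

Lemma lex_lt_far e z w : 0 < e -> far_pts e z w -> lex_lt z w = ~~ lex_lt w z.
Proof.
move=> e0; rewrite /lex_lt; case: (ltgtP z.1 w.1) => //= h1.
case: (ltgtP z.2 w.2) => //= h2.
have e4 : 0 < 4 * e by lra.
by rewrite /far_pts /near_pts h1 h2 !subrr normr0 e4.
Qed.

Lemma lex_or_higher e z w w' : 0 < e -> far_pts e z w -> near_pts e w w' ->
  lex_lt w z = lex_lt w' z \/ higher z w = ~~ higher w z.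
Proof.
move=> e0; rewrite /far_pts /near_pts negb_and -!leNgt !ltr_norml.
move=> h /andP[/andP[h1 h2] _]; case/orP: h; rewrite ler_normr => /orP[] h.
- by left; rewrite !lex_ltT //; lra.
- by left; rewrite !lex_ltF //; lra.
- by right; rewrite higherT ?higherF //; lra.
- by right; rewrite higherF ?higherT //; lra.
Qed.

(** Crossings above and below [z] together are the crossings of the vertical line through [z], whose
    parity depends only on the sides of the two ends. *)
Lemma cross_below_cross e z w f : 0 < e ->
  path (near_pts e) w f -> all (far_pts e z) (w :: f) ->
  cross_below w f z = cross w f z (+) (lex_lt w z (+) lex_lt (last w f) z).
Proof.
move=> e0; elim: f w => [|w' f IH] w /=; first by rewrite addbb.
move=> /andP[ww' pf] /andP[fw fs]; rewrite IH //.
have fw' : far_pts e z w' by case/andP: fs.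
rewrite (lex_lt_far e0 fw) (lex_lt_far e0 fw').
move: (cross _ _ _) (lex_lt (last _ _) _) => a b.
have [->|->] := lex_or_higher e0 fw ww'; first by rewrite !addbb.
by case: a; case: b; case: (lex_lt w z); case: (lex_lt w' z); case: (higher w z).
Qed.

(** This is [cross_sum] with [cross_below] eliminated, written in natural numbers so that instances
    can be added. *)
Lemma cross_relation e a s b f : 0 < e ->
  path (near_pts e) a s -> path (near_pts e) b f ->
  far_seqs e (a :: s) (b :: f) ->
  let x := last a s in let y := last b f in
  exists k : nat, (cross a s b + cross a s y + cross b f a + cross b f x +
    lex_lt b a + lex_lt y a + lex_lt b x + lex_lt y x = 2 * k)%N.
Proof.
move=> e0 ps pf far x y.
have fa : all (far_pts e a) (b :: f) by case/andP: far.
have fx : all (far_pts e x) (b :: f) by apply: (allP far); apply: mem_last.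
have := cross_sum ps pf far.
rewrite (cross_below_cross e0 pf fa) (cross_below_cross e0 pf fx) -/x -/y.
move: (cross a s b) (cross a s y) (cross b f a) (cross b f x) => c1 c2 c3 c4.
move: (lex_lt b a) (lex_lt y a) (lex_lt b x) (lex_lt y x) => l1 l2 l3 l4.
move=> h; exists ((c1 + c2 + c3 + c4 + l1 + l2 + l3 + l4)./2)%N.
by case: c1 h; case: c2; case: c3; case: c4; case: l1; case: l2; case: l3; case: l4.
Qed.

(* Mod 2 obstruction for K5: adding [cross_relation] over the 15 pairs of
   disjoint edges, each [cross] term occurs twice and the comparisons of end
   points add up to an odd number. *)
Lemma no_K5_chains e (p : nat -> R * R) (c : nat -> nat -> seq (R * R)) : 0 < e ->
  (forall i j, i < j < 5 -> p i != p j)%N ->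
  (forall i j, i < j < 5 -> path (near_pts e) (p i) (c i j))%N ->
  (forall i j, i < j < 5 -> last (p i) (c i j) = p j)%N ->
  (forall i j k l, i < j < 5 -> k < l < 5 -> i != k -> i != l -> j != k -> j != l ->
    far_seqs e (p i :: c i j) (p k :: c k l))%N -> False.
Proof.
move=> e0 pI pc lc fc.
have rel i j k l : (i < j < 5 -> k < l < 5 -> i != k -> i != l -> j != k -> j != l ->
    exists m : nat, cross (p i) (c i j) (p k) + cross (p i) (c i j) (p l) +
      cross (p k) (c k l) (p i) + cross (p k) (c k l) (p j) +
      lex_lt (p k) (p i) + lex_lt (p l) (p i) + lex_lt (p k) (p j) +
      lex_lt (p l) (p j) = 2 * m)%N.
  move=> ij kl h1 h2 h3 h4.
  have := cross_relation e0 (pc _ _ ij) (pc _ _ kl) (fc _ _ _ _ ij kl h1 h2 h3 h4).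
  by rewrite /= !lc.
have lt i j : (i < j < 5)%N -> (lex_lt (p j) (p i) + lex_lt (p i) (p j) = 1)%N.
  move=> /pI; rewrite /lex_lt eq_sym; case: (ltgtP (p i).1 (p j).1) => //= h1.
  case: (ltgtP (p i).2 (p j).2) => //= h2.
  by case: (p i) (p j) h1 h2 => [? ?] [? ?] /= -> ->; rewrite eqxx.
have [m0 h0] := rel 0 1 2 3 isT isT isT isT isT isT.
have [m1 h1] := rel 0 2 1 3 isT isT isT isT isT isT.
have [m2 h2] := rel 0 3 1 2 isT isT isT isT isT isT.
have [m3 h3] := rel 0 1 2 4 isT isT isT isT isT isT.
have [m4 h4] := rel 0 2 1 4 isT isT isT isT isT isT.
have [m5 h5] := rel 0 4 1 2 isT isT isT isT isT isT.
have [m6 h6] := rel 0 1 3 4 isT isT isT isT isT isT.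
have [m7 h7] := rel 0 3 1 4 isT isT isT isT isT isT.
have [m8 h8] := rel 0 4 1 3 isT isT isT isT isT isT.
have [m9 h9] := rel 0 2 3 4 isT isT isT isT isT isT.
have [m10 h10] := rel 0 3 2 4 isT isT isT isT isT isT.
have [m11 h11] := rel 0 4 2 3 isT isT isT isT isT isT.
have [m12 h12] := rel 1 2 3 4 isT isT isT isT isT isT.
have [m13 h13] := rel 1 3 2 4 isT isT isT isT isT isT.
have [m14 h14] := rel 1 4 2 3 isT isT isT isT isT isT.
have l01 := lt 0 1 isT; have l02 := lt 0 2 isT; have l03 := lt 0 3 isT.
have l04 := lt 0 4 isT; have l12 := lt 1 2 isT; have l13 := lt 1 3 isT.
have l14 := lt 1 4 isT; have l23 := lt 2 3 isT; have l24 := lt 2 4 isT.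
have l34 := lt 3 4 isT.
clear -h0 h1 h2 h3 h4 h5 h6 h7 h8 h9 h10 h11 h12 h13 h14
  l01 l02 l03 l04 l12 l13 l14 l23 l24 l34.
(* The rest is linear, so every bit becomes an unknown number; [l01] to [l34] say that two opposite
   comparisons add up to one. *)
do ![match goal with h : context [nat_of_bool ?b] |- _ =>
  move: (nat_of_bool b) h0 h1 h2 h3 h4 h5 h6 h7 h8 h9 h10 h11 h12 h13 h14
    l01 l02 l03 l04 l12 l13 l14 l23 l24 l34
    => ? h0 h1 h2 h3 h4 h5 h6 h7 h8 h9 h10 h11 h12 h13 h14
    l01 l02 l03 l04 l12 l13 l14 l23 l24 l34 end].
have := congr2 addn h0 (congr2 addn h1 (congr2 addn h2 (congr2 addn h3
  (congr2 addn h4 (congr2 addn h5 (congr2 addn h6 (congr2 addn h7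
  (congr2 addn h8 (congr2 addn h9 (congr2 addn h10 (congr2 addn h11
  (congr2 addn h12 (congr2 addn h13 h14))))))))))))).
clear -l01 l02 l03 l04 l12 l13 l14 l23 l24 l34.
lia.
Qed.

End CrossingParity.

(** * Connected and compact sets in the plane *)

Section Plane.
Local Open Scope classical_set_scope.
Local Open Scope ring_scope.

(** The points related to [x] form a relatively open and closed part of [S]. It serves both for
    chains of short steps and for [joined]. *)
Lemma connected_locally_related (X : topologicalType) (S : set X)
    (E : X -> X -> Prop) :
  connected S -> (forall x y z, E x y -> E y z -> E x z) ->
  (forall x, S x -> \forall y \near x, S y -> E x y /\ E y x) ->
  forall x y, S x -> S y -> E x y.
Proof.
move=> cS Etr Enear x y Sx Sy.
pose B := S `&` [set z | E x z].
suff BS : B = S by have [] : B y by rewrite BS.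
apply: cS.
- exists x; split=> //=.
  by have /nbhs_singleton /= /(_ Sx) [] := Enear x Sx.
- exists ([set z | S z -> E x z]°); first exact: open_interior.
  rewrite eqEsubset; split=> z [Sz].
    move=> /= Exz; split=> //; rewrite /interior /=.
    apply: filterS (Enear z Sz) => w h Sw; have [h1 _] := h Sw.
    exact: Etr Exz h1.
  by move=> /nbhs_singleton /= h; split=> //=; apply: h.
- exists (~` ([set z | S z -> ~ E x z]°)).
    exact/open_closedC/open_interior.
  rewrite eqEsubset; split=> z [Sz].
    by move=> /= Exz; split=> // /nbhs_singleton /=; apply.
  move=> nz; split=> //=; apply: contrapT => nE; apply: nz.
  rewrite /interior /=; apply: filterS (Enear z Sz) => w h Sw Exw.
  by apply: nE; have [_ h2] := h Sw; apply: Etr Exw h2.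
Qed.

Variable R : realType.
Implicit Types (X Y K F : set (R * R)) (x y z : R * R).

Lemma ball_near_pts x e y : ball x e y <-> near_pts e x y.
Proof.
rewrite /near_pts; split=> [[/= h1 h2]|/andP[h1 h2]].
  by move: h1 h2; rewrite -!ball_normE /ball_ /= => -> ->.
by split; rewrite -ball_normE.
Qed.

Lemma connected_chain K e x y : 0 < e -> connected K -> K x -> K y ->
  exists s, [/\ path (near_pts e) x s, last x s = y
              & forall z, z \in x :: s -> K z].
Proof.
move=> e0 cK Kx Ky.
apply: (@connected_locally_related _ K (fun x y => exists s,
  [/\ path (near_pts e) x s, last x s = y & forall z, z \in x :: s -> K z])) => //.
- move=> {Kx Ky}{}x {}y z [s [ps ls Ks]] [s' [ps' ls' Ks']]; exists (s ++ s'); split.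
  + by rewrite cat_path ps ls.
  + by rewrite last_cat ls.
  + move=> w; rewrite -cat_cons mem_cat => /orP[/Ks//|ws].
    by apply: Ks'; rewrite inE ws orbT.
- move=> {Kx}{}x Kx; apply/nbhs_ballP; exists e => //= z /ball_near_pts xz Kz.
  split; [exists [:: z]|exists [:: x]]; split=> //=.
  + by rewrite xz.
  + by move=> w; rewrite !inE => /orP[] /eqP->.
  + by rewrite near_pts_sym xz.
  + by move=> w; rewrite !inE => /orP[] /eqP->.
Qed.

Lemma compact_far K F : compact K -> closed F -> K `&` F = set0 ->
  \forall e \near 0^'+, forall x y, K x -> F y -> far_pts e x y.
Proof.
move=> /compact_near_coveringP cK cF KF.
have : \forall e \near (0 : R)^'+, K `<=` [set x | forall y, F y -> far_pts e x y].
  apply: (cK R 0^'+ (fun e x => forall y, F y -> far_pts e x y)) => x Kx.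
  have nFx : (~` F) x by move=> Fx; have : (K `&` F) x by []; rewrite KF.
  have /nbhs_ballP[r /= r0 hr] : nbhs x (~` F).
    by apply: open_nbhs_nbhs; split=> //; apply: closed_openC.
  (* The distance [4 * e] is below [r / 2], so with the radius [r / 2] around [x] it stays within
     [r]. *)
  exists (ball x (r / 2), [set e | e < r / 8]) => /=.
    split; first by apply: nbhsx_ballx; lra.
    by apply: nbhs_right_lt; lra.
  move=> [x' e] /= [/ball_near_pts/andP[h1 h2] er] y Fy; apply/negP => /andP[h3 h4].
  apply: (hr y) => //; apply/ball_near_pts/andP.
  move: h1 h2 h3 h4; rewrite !ltr_norml => /andP[? ?] /andP[? ?] /andP[? ?] /andP[? ?].
  by split; apply/andP; split; lra.
by apply: filterS => e h x y Kx; apply: h.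
Qed.

(* Mod 2 nonplanarity of K5; the sets of adjacent edges may meet. *)
Lemma no_K5_sets (p : nat -> R * R) (K : nat -> nat -> set (R * R)) :
  (forall i j, i < j < 5 -> p i != p j)%N ->
  (forall i j, i < j < 5 -> [/\ compact (K i j), connected (K i j),
                               K i j (p i) & K i j (p j)])%N ->
  (forall i j k l, i < j < 5 -> k < l < 5 -> i != k -> i != l -> j != k -> j != l ->
    K i j `&` K k l = set0)%N -> False.
Proof.
move=> pI KP Kd.
pose ok i j k l := [&& i < j < 5, k < l < 5, i != k, i != l, j != k & j != l]%N.
have : \forall e \near (0 : R)^'+, forall q : 'I_5 * 'I_5 * ('I_5 * 'I_5),
    ok q.1.1 q.1.2 q.2.1 q.2.2 ->
    forall x y, K q.1.1 q.1.2 x -> K q.2.1 q.2.2 y -> far_pts e x y.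
  apply: filter_forall => -[[i j] [k l]] /=.
  case: (boolP (ok i j k l)) => [okq|_]; last by apply: nearW.
  move: (okq) => /and5P[ij kl ik il /andP[jk jl]].
  have [cK _ _ _] := KP i j ij; have [cK' _ _ _] := KP k l kl.
  have clK' : closed (K k l) by apply: compact_closed cK'; exact: norm_hausdorff.
  have := compact_far cK clK' (Kd i j k l ij kl ik il jk jl).
  by apply: filterS => e h _.
move=> far; have [e [e0 {}far]] := @filter_ex _ (0 : R)^'+ _ _
  (filterI (nbhs_right_gt (0 : R)) far).
have /choice[c cP] : forall ij : nat * nat, exists s, (ij.1 < ij.2 < 5)%N ->
    [/\ path (near_pts e) (p ij.1) s, last (p ij.1) s = p ij.2
      & forall z, z \in p ij.1 :: s -> K ij.1 ij.2 z].
  move=> [i j] /=; case: (boolP (i < j < 5)%N) => ij; last by exists [::].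
  have [_ cK Ki Kj] := KP i j ij.
  by have [s hs] := connected_chain e0 cK Ki Kj; exists s.
apply: (@no_K5_chains _ e p (fun i j => c (i, j))) => //.
- by move=> i j ij; have [] := cP (i, j) ij.
- by move=> i j ij; have [] := cP (i, j) ij.
move=> i j k l ij kl ik il jk jl.
have [_ _ h1] := cP (i, j) ij; have [_ _ h2] := cP (k, l) kl.
apply/allP => z /h1 Kz; apply/allP => w /h2 Kw.
have i5 : (i < 5)%N by case/andP: ij => /ltn_trans h /h.
have k5 : (k < 5)%N by case/andP: kl => /ltn_trans h /h.
have j5 : (j < 5)%N by case/andP: ij.
have l5 : (l < 5)%N by case/andP: kl.
apply: (far ((Ordinal i5, Ordinal j5), (Ordinal k5, Ordinal l5))) => //=.
by rewrite /ok ij kl ik il jk jl.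
Qed.

(** Compact connected sets replace paths: they concatenate by union, and disjoint ones have positive
    distance. *)
Definition joined X x y : Prop :=
  exists K, [/\ compact K, connected K, K `<=` X, K x & K y].

Lemma joinedxx X x : X x -> joined X x x.
Proof.
move=> Xx; exists [set x]; split=> //; first exact: compact_set1.
  exact: connected1.
by move=> _ ->.
Qed.

Lemma joined_sym X x y : joined X x y -> joined X y x.
Proof. by move=> [K [? ? ? ? ?]]; exists K. Qed.

Lemma joined_trans X x y z : joined X x y -> joined X y z -> joined X x z.
Proof.
move=> [K [cK nK KX Kx Ky]] [L [cL nL LX Ly Lz]]; exists (K `|` L); split.
- exact: compactU.
- by apply: connectedU => //; exists y.
- by rewrite subUset.
- by left.
- by right.
Qed.

Lemma joined_sub X Y x y : X `<=` Y -> joined X x y -> joined Y x y.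
Proof.
move=> XY [K [cK nK KX Kx Ky]]; exists K; split=> //; exact: subset_trans XY.
Qed.

Lemma joined_image X (f : R -> R * R) : {within `[0, 1], continuous f} ->
  f @` `[0, 1] `<=` X -> joined X (f 0) (f 1).
Proof.
move=> cf fX; exists (f @` `[0, 1]); split=> //.
- by apply: continuous_compact => //; apply: segment_compact.
- by apply: connected_continuous_connected => //; apply: segment_connected.
- by exists 0 => //=; rewrite in_itv /= lexx ler01.
- by exists 1 => //=; rewrite in_itv /= lexx ler01.
Qed.

Lemma joined_segment X x y :
  (forall t, 0 <= t <= 1 ->
     X (x.1 + t * (y.1 - x.1), x.2 + t * (y.2 - x.2))) -> joined X x y.
Proof.
move=> hX.
pose f t : R * R := (x.1 + t * (y.1 - x.1), x.2 + t * (y.2 - x.2)).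
have f0 : f 0 = x by rewrite /f !mul0r !addr0 -surjective_pairing.
have f1 : f 1 = y by rewrite /f !mul1r !subrKC -surjective_pairing.
suff : joined X (f 0) (f 1) by rewrite f0 f1.
apply: joined_image; last by move=> z [t /=]; rewrite in_itv /= => ht <-; apply: hX.
apply: continuous_subspaceT => t.
apply: (@cvg_pair _ _ _ _ (nbhs (f t).1) (nbhs (f t).2)).
  by apply: cvgD; [apply: cvg_cst|apply: cvgM; [apply: cvg_id|apply: cvg_cst]].
by apply: cvgD; [apply: cvg_cst|apply: cvgM; [apply: cvg_id|apply: cvg_cst]].
Qed.

Lemma joined_ball x e y : ball x e y -> joined (ball x e) x y.
Proof.
move=> /ball_near_pts/andP[h1 h2]; apply: joined_segment => t /andP[t0 t1].
apply/ball_near_pts/andP => /=.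
rewrite !opprD !addNKr !normrN !normrM (ger0_norm t0).
split.
  by apply: le_lt_trans h1; rewrite distrC; apply: ler_piMl.
by apply: le_lt_trans h2; rewrite distrC; apply: ler_piMl.
Qed.

Lemma joined_component X x y : open X -> connected_component X x y -> joined X x y.
Proof.
move=> oX xy.
have Xx : X x.
  by apply: contrapT => /connected_component_out nx; rewrite nx in xy.
apply: (connected_locally_related (@component_connected _ X x)) => //.
- exact: joined_trans.
- move=> z /connected_component_sub Xz.
  have /nbhs_ballP[e /= e0 he] : nbhs z X by apply: open_nbhs_nbhs.
  apply/nbhs_ballP; exists e => //= w zw _.
  have j : joined X z w := joined_sub he (joined_ball zw).
  by split=> //; apply: joined_sym.
- exact: connected_component_refl.
Qed.

Lemma compact_finite_union (I : finType) (P : pred I) (A : I -> set (R * R)) :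
  (forall i, P i -> compact (A i)) -> compact [set x | exists2 i, P i & A i x].
Proof.
move=> cA.
have -> : [set x | exists2 i, P i & A i x] =
    \big[setU/set0]_(i <- enum I | P i) A i.
  rewrite -bigcup_seq_cond eqEsubset; split=> x [i /=].
    by move=> Pi Aix; exists i => //=; rewrite mem_enum.
  by move=> /andP[_ Pi] Aix; exists i.
exact: bigsetU_compact.
Qed.

End Plane.

(** * Drawings and their outer face *)

Section Drawings.
Local Open Scope ring_scope.
Local Open Scope classical_set_scope.
Variables (R : realType) (V : finType) (G : sgraph V) (D : plane_drawing R G).

Definition region (Z : {set V}) : set (R * R) :=
  [set p | (exists2 x, x \in Z & p = point D x) \/
           (exists x y, [/\ x \in Z, y \in Z, adj G x y & arc D x y p])].

Lemma region_point (Z : {set V}) x : x \in Z -> region Z (point D x).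
Proof. by move=> xZ; left; exists x. Qed.

Lemma region_sub (Z Z' : {set V}) : Z \subset Z' -> region Z `<=` region Z'.
Proof.
move=> /fintype.subsetP ZZ' p [[x xZ ->]|[x [y [xZ yZ xy h]]]].
  by left; exists x => //; apply: ZZ'.
by right; exists x, y; split=> //; apply: ZZ'.
Qed.

Lemma region_drawn (Z : {set V}) : region Z `<=` drawn D.
Proof.
move=> p [[x xZ ->]|[x [y [xZ yZ xy h]]]]; first by left; exists x.
by right; exists x, y.
Qed.

Lemma drawn_region : drawn D `<=` region [set: V]%SET.
Proof.
move=> p [[x _ <-]|[x [y [xy h]]]]; first by left; exists x; rewrite ?inE.
by right; exists x, y; rewrite !inE.
Qed.

Lemma arc_image x y : adj G x y -> exists f : R -> R * R,
  [/\ {within `[0, 1], continuous f}, f 0 = point D x, f 1 = point D y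
    & arc D x y = f @` `[0, 1]].
Proof. by move=> /(arcP D)[f [? _ ? ? ?]]; exists f. Qed.

Lemma compact_region (Z : {set V}) : compact (region Z).
Proof.
have -> : region Z =
    [set p | exists2 x, x \in Z & [set point D x] p] `|`
    [set p | exists2 xy : V * V, [&& xy.1 \in Z, xy.2 \in Z & adj G xy.1 xy.2]
                              & arc D xy.1 xy.2 p].
  rewrite eqEsubset; split=> p.
    case=> [[x xZ ->]|[x [y [xZ yZ xy h]]]]; first by left; exists x.
    by right; exists (x, y) => //=; rewrite xZ yZ.
  case=> [[x xZ ->]|[[x y] /= /and3P[xZ yZ xy] h]]; first by left; exists x.
  by right; exists x, y.
apply: compactU.
  by apply: (compact_finite_union (P := mem Z)) => x _; apply: compact_set1.
apply: (compact_finite_union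
  (P := fun xy : V * V => [&& xy.1 \in Z, xy.2 \in Z & adj G xy.1 xy.2])).
move=> [x y] /= /and3P[_ _ /arc_image[f [cf _ _ ->]]].
by apply: continuous_compact => //; apply: segment_compact.
Qed.

Lemma compact_drawn : compact (drawn D).
Proof.
suff -> : drawn D = region [set: V]%SET by apply: compact_region.
by rewrite eqEsubset; split; [apply: drawn_region|apply: region_drawn].
Qed.

Lemma closed_region (Z : {set V}) : closed (region Z).
Proof. by apply: compact_closed (@compact_region Z); exact: norm_hausdorff. Qed.

Lemma closed_drawn : closed (drawn D).
Proof. by apply: compact_closed compact_drawn; exact: norm_hausdorff. Qed.

Lemma region_disjoint (Z Z' : {set V}) :
  (forall x, x \in Z -> x \in Z' -> False) -> region Z `&` region Z' = set0.
Proof.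
move=> nZ; rewrite -subset0 => p [].
move=> [[x xZ ->]|[x [y [xZ yZ xy hp]]]] [[x' xZ' e]|[x' [y' [xZ' yZ' xy' hp']]]].
- by move/point_inj: e => e; apply: (nZ x) => //; rewrite e.
- by have [e|e] := arc_point xy' hp'; apply: (nZ x) => //; rewrite e.
- rewrite e in hp; have [e'|e'] := arc_point xy hp.
    by apply: (nZ x) => //; rewrite -e'.
  by apply: (nZ y) => //; rewrite -e'.
- have ne : [set x; y] <> [set x'; y'].
    move=> /seteqP[/(_ x (or_introl erefl))[] e _]; apply: (nZ x) => //;
    by rewrite e.
  have [z [[->|->] [e|e]] _] := arc_meet xy xy' ne (conj hp hp').
  + by apply: (nZ x) => //; rewrite e.
  + by apply: (nZ x) => //; rewrite e.
  + by apply: (nZ y) => //; rewrite e.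
  + by apply: (nZ y) => //; rewrite e.
Qed.

Lemma joined_region (Z : {set V}) x y : x \in Z ->
  connect (induced (adj G) Z) x y -> joined (region Z) (point D x) (point D y).
Proof.
move=> xZ /connectP[p]; elim: p x xZ => [|z p IH] x xZ /=.
  by move=> _ ->; apply: joinedxx; apply: region_point.
move=> /andP[/and3P[_ zZ xz] pp] e.
apply: joined_trans (IH z zZ pp e).
have [f [cf <- <- ef]] := arc_image xz; apply: joined_image => //.
by move=> w hw; right; exists x, z; split=> //; rewrite ef.
Qed.

Lemma drawn_box : exists2 M : R, 0 <= M &
  forall z, drawn D z -> `|z.1| <= M /\ `|z.2| <= M.
Proof.
have [M [_ hM]] := compact_bounded compact_drawn.
exists (`|M| + 1); first by rewrite addr_ge0.
move=> z Dz.
have : `|z| <= `|M| + 1.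
  by apply: (hM (`|M| + 1)) => //; rewrite (le_lt_trans (ler_norm M)) // ltrDl.
by rewrite prod_normE /= ge_max => /andP[].
Qed.

(** Outside a box around the drawing, a horizontal and a vertical segment join any point to the
    fixed point [c]; an unbounded component leaves the box. *)
Lemma outer_face_joined : exists2 p0, ~ drawn D p0 &
  forall q, outer_face D q -> joined (~` drawn D) p0 q.
Proof.
have [M M0 hM] := drawn_box.
pose c : R * R := (M + 1, M + 1).
have out z : M < `|z.1| \/ M < `|z.2| -> (~` drawn D) z.
  by move=> h /hM[h1 h2]; case: h => h; move: h; rewrite ltNge ?h1 ?h2.
have Mc : M < `|M + 1| by rewrite ger0_norm; lra.
have far z : M < `|z.1| \/ M < `|z.2| -> joined (~` drawn D) c z.
  move=> [h|h].
    apply: (@joined_trans _ _ _ (z.1, M + 1)).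
      by apply: joined_segment => t _ /=; apply: out; right=> /=; rewrite subrr mulr0 addr0.
    by apply: joined_segment => t _ /=; apply: out; left=> /=; rewrite subrr mulr0 addr0.
  apply: (@joined_trans _ _ _ (M + 1, z.2)).
    by apply: joined_segment => t _ /=; apply: out; left=> /=; rewrite subrr mulr0 addr0.
  by apply: joined_segment => t _ /=; apply: out; right=> /=; rewrite subrr mulr0 addr0.
exists c; first by apply: out; left.
move=> q [Dq ub].
have [z qz zM] : exists2 z, connected_component (~` drawn D) q z &
    M < `|z.1| \/ M < `|z.2|.
  apply: contrapT => no; apply: ub; exists M; split; first exact: num_real.
  move=> N MN z qz /=; apply: le_trans (ltW MN); rewrite prod_normE ge_max.
  apply/andP; split; rewrite leNgt; apply/negP => h; apply: no; exists z => //.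
    by left.
  by right.
apply: joined_trans (far z zM) _; apply: joined_sym; apply: joined_component qz.
exact/closed_openC/closed_drawn.
Qed.

End Drawings.

(** * Outerplanar graphs have no K4 minor *)

Section OuterplanarMinors.
Local Open Scope ring_scope.
Local Open Scope classical_set_scope.

(* The fifth vertex of a K5 lies in the outer face: being in its closure, each
   [v i] is reached from there without meeting the other arcs of the model. *)
Theorem outerplanar_K4_free (R : realType) (V : finType) (G : sgraph V) :
  outerplanar R G -> ~ K4_minor (adj G) [set: V]%SET.
Proof.
move=> [D outer] [A [_ A0 Ac Ad Ae]].
have [p0 Dp0 p0J] := outer_face_joined D.
have /choice[v vA] : forall i, exists x, x \in A i.
  by move=> i; apply/set0Pn.
have disj i j x : i != j -> x \in A i -> x \in A j -> False.
  by move=> ij xi xj; have := disjointFr (Ad i j ij) xi; rewrite xj.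
have J i j : i != j -> joined (region D (A i :|: A j)%SET) (point D (v i)) (point D (v j)).
  move=> ij; have [x [y [xi yj xy]]] := Ae i j ij.
  have si : A i \subset (A i :|: A j)%SET by apply: finset.subsetUl.
  have sj : A j \subset (A i :|: A j)%SET by apply: finset.subsetUr.
  apply: (@joined_trans _ _ _ (point D x)).
    apply: joined_sub (region_sub si) _; apply: joined_region => //.
    by apply: Ac => //; apply: vA.
  apply: (@joined_trans _ _ _ (point D y)).
    apply: joined_region; first by rewrite inE xi.
    by apply: connect1; rewrite /induced /= !inE xi yj orbT.
  apply: joined_sub (region_sub sj) _; apply: joined_region => //.
  by apply: Ac => //; apply: vA.
(* Every edge of K5 disjoint from the one between [v i] and the fifth vertex is drawn inside the
   region of [others i], so only this region has to be avoided. *)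
pose others i := (\bigcup_(j | j != i) A j)%SET.
have vo i : ~ region D (others i) (point D (v i)).
  move=> h; have : (region D (others i) `&` region D [set v i]%SET) (point D (v i)).
    by split=> //; apply: region_point; rewrite inE.
  rewrite region_disjoint // => x /bigcupP[j ji xj]; rewrite inE => /eqP e.
  by apply: (disj j i (v i)) => //; rewrite -e.
have JO i : joined (~` region D (others i)) (point D (v i)) p0.
  have : nbhs (point D (v i)) (~` region D (others i)).
    by apply: open_nbhs_nbhs; split; [apply/closed_openC/closed_region|exact: vo].
  move=> /nbhs_ballP[e /= e0 he].
  have [q [oq qb]] : (outer_face D `&` ball (point D (v i)) e) !=set0.
    by apply: outer; apply: nbhsx_ballx.
  apply: (joined_trans (y := q)); first exact: joined_sub he (joined_ball qb).
  apply: joined_sym; apply: joined_sub (p0J q oq).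
  by apply: subsetC; apply: region_drawn.
(* The vertices of K5 are numbered 0 to 4, with 4 for [p0]; [o] is meaningful only below 4. *)
pose o i : 'I_4 := inord i.
have oE i j : (i < 4)%N -> (j < 4)%N -> (o i == o j) = (i == j).
  by move=> i4 j4; rewrite -val_eqE /= !inordK.
pose P i := if (i < 4)%N then point D (v (o i)) else p0.
have /choice[K KP] : forall ij : nat * nat, exists K, (ij.1 < ij.2 < 5)%N ->
    [/\ compact K, connected K,
      K `<=` (if (ij.2 < 4)%N then region D (A (o ij.1) :|: A (o ij.2))%SET
              else ~` region D (others (o ij.1))), K (P ij.1) & K (P ij.2)].
  move=> [i j] /=; case: (boolP (i < j < 5)%N) => [/andP[ij j5]|_]; last by exists set0.
  have i4 : (i < 4)%N by apply: leq_trans ij _.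
  rewrite /P i4; case: (ltnP j 4) => j4.
    have [|K hK] := J (o i) (o j); first by rewrite oE // ltn_eqF.
    by exists K.
  by have [K hK] := JO (o i); exists K.
have KR i j k l : (i < j < 4 -> k < l < 4 -> i != k -> i != l -> j != k -> j != l ->
    region D (A (o i) :|: A (o j))%SET `&` region D (A (o k) :|: A (o l))%SET = set0)%N.
  move=> /andP[ij j4] /andP[kl l4] ik il jk jl.
  have i4 := ltn_trans ij j4; have k4 := ltn_trans kl l4.
  apply: region_disjoint => x; rewrite !inE => /orP[] h1 /orP[] h2.
  - by apply: disj h1 h2; rewrite oE.
  - by apply: disj h1 h2; rewrite oE.
  - by apply: disj h1 h2; rewrite oE.
  - by apply: disj h1 h2; rewrite oE.
have KO i k l : (i < 4 -> k < l < 4 -> i != k -> i != l ->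
    region D (A (o k) :|: A (o l))%SET `<=` region D (others (o i)))%N.
  move=> i4 /andP[kl l4] ik il; have k4 := ltn_trans kl l4.
  apply: region_sub; rewrite finset.subUset; apply/andP; split.
    by apply: (finset.bigcup_sup (o k)); rewrite oE // eq_sym.
  by apply: (finset.bigcup_sup (o l)); rewrite oE // eq_sym.
apply: (@no_K5_sets R P (fun i j => K (i, j))).
- move=> i j /andP[ij j5]; have i4 : (i < 4)%N by apply: leq_trans ij _.
  rewrite /P i4; case: (ltnP j 4) => j4; apply/eqP.
    move=> /point_inj e; apply: (disj (o i) (o j) (v (o i))) => //.
    + by rewrite oE // ltn_eqF.
    + by rewrite e.
  by move=> e; apply: Dp0; rewrite -e; left; exists (v (o i)).
- by move=> i j ij; have [] := KP (i, j) ij.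
move=> i j k l ij kl ik il jk jl.
have [_ _ + _ _] := KP (i, j) ij; have [_ _ + _ _] := KP (k, l) kl => /=.
move: ij kl => /andP[ij j5] /andP[kl l5].
have i4 : (i < 4)%N by apply: leq_trans ij _.
have k4 : (k < 4)%N by apply: leq_trans kl _.
case: (ltnP j 4) => j4; case: (ltnP l 4) => l4 Kkl Kij; rewrite -subset0 => z [z1 z2].
- suff <- : region D (A (o i) :|: A (o j))%SET `&` region D (A (o k) :|: A (o l))%SET = set0.
    by split; [apply: Kij|apply: Kkl].
  by apply: KR => //; rewrite ?ij ?kl.
- apply: (Kkl z z2); apply: (KO k i j) (Kij z z1) => //; rewrite 1?eq_sym //.
  by rewrite ij.
- apply: (Kij z z1); apply: (KO i k l) (Kkl z z2) => //.
  by rewrite kl.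
- by case/negP: jl; rewrite eqn_leq (leq_trans _ l4) // (leq_trans _ j4).
Qed.

End OuterplanarMinors.

(** * Estimates for the total time *)

Section Time.

(** For positive [d], raise [l.+1 <= d * 2 ^ (l %/ d)] to the power [d]. *)
Lemma poly_le_exp2 (d : nat) : exists c, forall l, l.+1 ^ d <= c * 2 ^ l.
Proof.
case: d => [|d]; first by exists 1 => l; rewrite expn0 mul1n expn_gt0.
exists (d.+1 ^ d.+1) => l.
apply: (@leq_trans ((d.+1 * 2 ^ (l %/ d.+1)) ^ d.+1)).
  rewrite leq_exp2r //; apply: (@leq_trans (d.+1 * (l %/ d.+1).+1)).
    by rewrite {1}(divn_eq l d.+1) mulnC mulnS addnC -addSn leq_add2r ltn_mod.
  by rewrite leq_mul2l ltn_expl ?orbT.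
rewrite expnMn leq_mul2l -expnM leq_exp2l // orbC.
by rewrite {2}(divn_eq l d.+1) leq_addr.
Qed.

(** One scale up costs a factor [100 * K ^ 5 * x]: [5 * K * x] and [2 * K] for the repetitions,
    [2 * K ^ 2] for the periods, [5 * K] for one period. *)
Lemma level_time_le (K h x i : nat) : 0 < K -> h <= K -> 0 < x ->
  level_time K h x i <= (100 * K ^ 5) ^ i.+1 * x ^ i.+1.
Proof.
move=> K0 hK x0; elim: i => [|i IH].
  rewrite /= !expn1; apply: (@leq_trans (8 * K ^ 3)).
    by rewrite !expnS expn0; move: K0; clear; nia.
  apply: (@leq_trans (100 * K ^ 5)); last by rewrite leq_pmulr.
  by apply: leq_mul => //; rewrite leq_pexp2l.
rewrite /=; set a := _ ^ i.+1 in IH *.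
have a0 : 0 < a by rewrite !(expn_gt0, muln_gt0) K0.
have X0 : 0 < x ^ i.+1 by rewrite expn_gt0 x0.
rewrite [(100 * K ^ 5) ^ _]expnS [x ^ i.+2]expnS -/a.
move: (level_time _ _ _ _) (x ^ i.+1) X0 IH => L X X0 IH.
apply: (@leq_trans ((5 * K * x) * (2 * K) * ((2 * K ^ 2) * (5 * K * (a * X))))); last first.
  by apply: eq_leq; rewrite !expnS expn0; lia.
apply: leq_mul; first by rewrite leq_mul2r; apply/orP; right; move: hK K0 x0; clear; nia.
apply: leq_mul; first by rewrite expnS expn1; move: K0; clear; nia.
have : X <= a * X by rewrite leq_pmull.
by move: IH K0 X0 a0; move: (a * X) => Y; clear; nia.
Qed.

(** Here [y ^ 12] stands for n, so [x = y ^ 3]. The level time has 25 factors [K], and [r * (2 * K)]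
    contributes two more; as [K] is logarithmic in [y], all 27 cost at most a constant times [y],
    which turns [y ^ 15] into [y ^ 16]. *)
Lemma exploration_parameters : exists c, forall y, 1 < y -> exists h K r,
  [/\ 3 ^ h * y ^ 3 <= 4 ^ h, 1 + 3 * h * 4 <= K, y ^ 12 < 2 ^ r
    & r * (2 * K * level_time K h (y ^ 3) 4) <= c * y ^ 16].
Proof.
have [c hc] := poly_le_exp2 27.
exists (4 * 100 ^ 5 * 108 ^ 27 * c) => y y1.
pose l := up_log 2 y.
have yl : y <= 2 ^ l by apply: up_logP.
have l0 : 0 < l by rewrite up_log_gt0.
have ly : 2 ^ l <= 2 * y.
  have /andP[h _] := up_log_bounds (isT : 1 < 2) y1.
  by rewrite -(prednK l0) expnS leq_mul2l /= ltnW.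
(* The 9 works because [3 ^ 9 * 2 ^ 3 <= 4 ^ 9] and [y <= 2 ^ l]; then 108 is [3 * 9 * 4]. *)
exists (9 * l), (108 * l).+1, (12 * l).+1; split.
- apply: (@leq_trans (3 ^ (9 * l) * 2 ^ (3 * l))).
    by rewrite leq_mul2l [3 * l]mulnC [2 ^ _]expnM leq_exp2r ?yl ?orbT.
  rewrite [3 ^ _]expnM [2 ^ _]expnM [4 ^ _]expnM -expnMn leq_exp2r //.
- lia.
- apply: (@leq_ltn_trans (2 ^ (12 * l))); last by rewrite ltn_exp2l.
  by rewrite [12 * l]mulnC expnM leq_exp2r.
set K := (108 * l).+1.
have K0 : 0 < K by [].
have hK : 9 * l <= K by rewrite /K; lia.
have rK : (12 * l).+1 <= K by rewrite /K; lia.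
have y30 : 0 < y ^ 3 by rewrite expn_gt0 ltnW.
have hL := level_time_le 4 K0 hK y30.
have KE : K ^ 27 <= 108 ^ 27 * c * (2 * y).
  apply: (@leq_trans ((108 * l.+1) ^ 27)); first by rewrite leq_exp2r // /K; lia.
  rewrite expnMn -mulnA leq_mul2l; apply/orP; right.
  by apply: leq_trans (hc l) _; rewrite leq_mul2l ly orbT.
rewrite expnMn -!expnM in hL.
apply: (@leq_trans (K * (2 * K * (100 ^ 5 * K ^ 25 * y ^ 15)))).
  apply: leq_mul => //; rewrite leq_mul2l; apply/orP; right.
  exact: hL.
have -> : K * (2 * K * (100 ^ 5 * K ^ 25 * y ^ 15)) = 2 * 100 ^ 5 * K ^ 27 * y ^ 15.
  by rewrite [K ^ 27](expnD K 2 25) -mulnn; move: (100 ^ 5) (K ^ 25) => *; ring.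
have -> : 4 * 100 ^ 5 * 108 ^ 27 * c * y ^ 16 =
    2 * 100 ^ 5 * (108 ^ 27 * c * (2 * y)) * y ^ 15.
  by rewrite [y ^ 16]expnS; move: (100 ^ 5) (108 ^ 27) (y ^ 15) => *; ring.
by rewrite leq_mul2r leq_mul2l KE !orbT.
Qed.

End Time.

(** * From trips to temporal walks, and the final bound *)

Local Open Scope ring_scope.

(** Trips live on an infinite sequence: [insubd i0] repeats snapshot [i0] from time [T] on, where a
    trip ending by [T] never moves. The last two conclusions let the induction append a step at the
    right place and time. *)
Lemma trip_temporal_walk (V : finType) (T : nat) (G : temporal_graph V T)
    (i0 : 'I_T) t t' x y (S : {set V}) :
  trip (fun t => adj (G (insubd i0 t))) t t' x y S -> (t' <= T)%N ->
  exists w : seq (step V T),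
    [/\ temporal_walk G x w, forall v, v \in S -> v \in visited x w,
        last x [seq a.1.2 | a : step V T <- w] = y
      & forall a, a \in w -> (a.2 < t')%N].
Proof.
elim=> {t t' x y S} [t x _|t t' x y S _ IH tT|t t' x y z S _ IH Ayz tT].
- by exists [::]; split=> // v; rewrite !inE.
- have [w [tw vw lw hw]] := IH (ltnW tT); exists w; split=> // a /hw h.
  exact: ltnW.
have [w [tw vw lw hw]] := IH (ltnW tT).
have et : insubd i0 t' = t' :> nat by rewrite val_insubd tT.
exists (rcons w (y, z, insubd i0 t')); split.
- move: tw => /and3P[aw sw hd]; apply/and3P; split.
  + by rewrite all_rcons /= Ayz.
  + case: w {vw aw hd} lw hw sw => [//|a w] /= lw hw sw.
    rewrite rcons_path sw /= /follows /= et.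
    rewrite -lw (last_map (fun a : step V T => a.1.2)) eqxx /=.
    by apply: hw; rewrite mem_last.
  + by case: w {vw aw hd sw hw} lw hd => [/= ->|].
- move=> v; rewrite /visited map_rcons -rcons_cons mem_rcons !inE.
  case/orP => [->//|/vw]; rewrite /visited inE => ->.
  by rewrite orbT.
- by rewrite map_rcons last_rcons.
- move=> a; rewrite mem_rcons inE => /orP[/eqP->|/hw h]; last exact: ltnW.
  by rewrite /= et.
Qed.

(** Taking roots reduces this to [(y / 2) ^ 12 <= n], which holds as [y / 2 <= y - 1]. *)
Lemma powR_four_thirds_ge (R : realType) (n y : nat) : (1 < y)%N ->
  (y.-1 ^ 12 < n)%N -> (y%:R / 2) ^+ 16 <= n%:R `^ (4%:R / 3%:R) :> R.
Proof.
move=> y1 yn; pose b : R := n%:R `^ (3%:R^-1).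
have n0 : 0 <= n%:R :> R by [].
have b0 : 0 <= b by apply: powR_ge0.
have b3 : b ^+ 3 = n%:R.
  by rewrite -powR_mulrn // -powRrM mulVf ?powRr1 // pnatr_eq0.
have -> : n%:R `^ (4%:R / 3%:R) = b ^+ 4 by rewrite -powR_mulrn // -powRrM mulrC.
have c0 : 0 <= (y%:R / 2 : R) by rewrite divr_ge0.
rewrite (exprM _ 4 4) lerXn2r ?nnegrE ?exprn_ge0 //.
rewrite -(@ler_pXn2r _ 3) ?nnegrE ?exprn_ge0 // b3 -exprM.
apply: (@le_trans _ _ (y.-1%:R ^+ 12)); last by rewrite -natrX ler_nat ltnW.
rewrite lerXn2r ?nnegrE // ler_pdivrMr // -natrM ler_nat.
by lia.
Qed.

Theorem theorem5 (R : realType) :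
  exists2 C : R, 0 < C &
  forall (V : finType) (T : nat) (G : temporal_graph V T),
    (2 <= #|V|)%N ->
    always_connected G ->
    outerplanar R (underlying G) ->
    exploration_bound C #|V| <= T%:R ->
    forall s : V,
    exists w : seq (step V T),
      [/\ temporal_walk G s w,
          forall v : V, v \in visited s w
        & forall a : step V T, a \in w ->
            Posz (nat_of_ord a.2).+1 <= Num.ceil (exploration_bound C #|V|)].
Proof.
have [c hc] := exploration_parameters.
pose d : R := (ln 2) `^ (5%:R / 2%:R).
have ln2_gt0 : 0 < ln 2 :> R by rewrite ln_gt0 // ltr1n.
have d0 : 0 < d by rewrite powR_gt0.
(* [2 ^ 16] pays for [y / 2] in place of [y], [d] is the logarithmic factor at its smallest, for two
   vertices, and the successor keeps the constant positive. *)
exists ((c.+1 * 2 ^ 16)%:R / d).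
  by rewrite divr_gt0 // ltr0n muln_gt0 expn_gt0.
move=> V T G n2 Gc Gout; set E := exploration_bound _ _ => ET s.
have [y [y1 yn ny]] : exists y, [/\ (1 < y)%N, (y.-1 ^ 12 < #|V|)%N & (#|V| <= y ^ 12)%N].
  have ex : exists y, (#|V| <= y ^ 12)%N.
    by exists #|V|; rewrite -{1}[#|V|]expn1 leq_pexp2l // ltnW.
  case: (ex_minnP ex) => y hy ymin.
  have y1 : (1 < y)%N.
    by case: (y) hy => [|[|//]] hy; have := leq_trans n2 hy; rewrite ?exp0n ?exp1n.
  exists y; split=> //; rewrite ltnNge; apply/negP => /ymin.
  by rewrite -ltnS prednK ?ltnn // ltnW.
have [h [K [r [h1 h2 h3 h4]]]] := hc y y1.
set tau := (r * _)%N in h4.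
have tauE : tau%:R <= E.
  have n0 : (0 < #|V|)%N by apply: ltnW.
  have b1 := powR_four_thirds_ge R y1 yn.
  have b2 : d <= (ln #|V|%:R) `^ (5%:R / 2%:R).
    apply: ge0_ler_powR; first by rewrite divr_ge0.
    + by rewrite nnegrE ltW.
    + by rewrite nnegrE ltW // ln_gt0 // ltr1n.
    + by rewrite ler_ln ?posrE ?ltr0n // ler_nat.
  apply: (@le_trans _ _ ((c.+1 * 2 ^ 16)%:R / d * (y%:R / 2) ^+ 16 * d)).
    rewrite mulrAC divfK ?gt_eqF //.
    rewrite natrM natrX -mulrA -exprMn (_ : 2%:R * (y%:R / 2) = y%:R); last by field.
    rewrite -natrX -natrM ler_nat.
    by apply: leq_trans h4 _; rewrite leq_mul2r leqnSn orbT.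
  rewrite /E /exploration_bound; apply: ler_pM => //.
  - by rewrite mulr_ge0 ?exprn_ge0 ?divr_ge0 // ltW.
  - exact: ltW.
  - by rewrite ler_wpM2l // divr_ge0 // ltW.
have tauT : (tau <= T)%N by rewrite -(ler_nat R); apply: le_trans tauE ET.
have T0 : (0 < T)%N.
  rewrite -(ltr_nat R); apply: lt_le_trans ET; rewrite /E /exploration_bound.
  rewrite !mulr_gt0 ?powR_gt0 ?invr_gt0 ?ltr0n ?muln_gt0 ?expn_gt0 ?(ltnW n2) //.
  by rewrite ln_gt0 // ltr1n.
pose i0 : 'I_T := Ordinal T0.
pose A t := adj (G (insubd i0 t)).
have A_sym t : symmetric (A t) by move=> x x'; apply: adj_sym.
have A_sub t x x' : A t x x' -> adj (underlying G) x x'.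
  by move=> hA; apply/existsP; exists (insubd i0 t).
have A_conn t x x' : connect (A t) x x' by apply: Gc.
have V0 : [set: V]%SET != finset.set0 by apply/set0Pn; exists s; rewrite inE.
have [root [rank [par [up Tr]]]] := tree_order_exists
  (@adj_sym _ (underlying G)) (@adj_irr _ (underlying G)) V0
  (outerplanar_K4_free Gout).
have y30 : (0 < y ^ 3)%N by rewrite expn_gt0 ltnW.
have Vx : (#|V| <= (y ^ 3) ^ 4)%N by rewrite -expnM.
have Vr : (#|V| < 2 ^ r)%N by apply: leq_ltn_trans ny h3.
have tr := exploration A_sym A_sub A_conn (@adj_sym _ (underlying G)) Tr s
  y30 h1 h2 Vx Vr.
have [w [tw vw _ hw]] := trip_temporal_walk tr tauT.
exists w; split=> //; first by move=> v; apply: vw; rewrite inE.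
move=> a /hw ha; rewrite -(ler_int R); apply: le_trans (ceil_ge _).
by apply: le_trans tauE; rewrite ler_nat.
Qed.
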